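(* Let $(E,\rho,[\cdot,\cdot]_E,L)$ be a local almost-Leibniz algebroid over $M$ and let $(g,\nabla,\nabla^* )$ be a conjugate $E$-connection structure such that $\nabla$ and $\nabla^*$ are both admissible, $\nabla$ is $E$-torsion-free, and $$T(\nabla^* )(u, v) = [u, v]_E^{\nabla} - [u, v]_E^{\nabla^*}\quad\text{for all }u,v\in\mathfrak{X}(E).$$ Then, with $C := -Q(\nabla,g)$ and $B := T(\nabla^* )$, the triplet $(g,C,B)$ is an $E$-statistical structure.
   Context: Everything is smooth; $M$ is an orientable, paracompact, Hausdorff smooth manifold, $E\to M$ a real vector bundle, $\mathfrak{X}(E)=\Gamma(E)$, $\Omega^1(E)=\Gamma(E^* )$. An anchored vector bundle $(E,\rho)$ is a vector bundle $E$ with a vector bundle morphism $\rho:E\to T(M)$ over the identity. A linear $E$-connection is an $\mathbb{R}$-bilinear map $\nabla:\mathfrak{X}(E)\times\mathfrak{X}(E)\to\mathfrak{X}(E)$ with $\nabla_u(fv)=\rho(u)(f)v+f\nabla_u v$ and $\nabla_{fu}v=f\nabla_u v$. An $E$-metric is a symmetric non-degenerate section $g$ of $E^*\otimes E^*$. A local almost-Leibniz algebroid $(E,\rho,[\cdot,\cdot]_E,L)$ is an anchored vector bundle with an $\mathbb{R}$-bilinear bracket $[\cdot,\cdot]_E$ on $\mathfrak{X}(E)$ and a $C^\infty(M,\mathbb{R})$-multilinear map $L:\Omega^1(E)\times\mathfrak{X}(E)\times\mathfrak{X}(E)\to\mathfrak{X}(E)$ with $[u,fv]_E=\rho(u)(f)v+f[u,v]_E$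 and $[fu,v]_E=-\rho(v)(f)u+f[u,v]_E+L(Df,u,v)$, where $(Df)(u):=\rho(u)(f)$. For a linear $E$-connection $\nabla$ the modified bracket is $[u,v]_E^{\nabla}:=[u,v]_E-L(e^a,\nabla_{X_a}u,v)$ (sum over $a$), where $(X_a)$ is any local frame of $E$ with dual coframe $(e^a)$. $\nabla$ is admissible if $[u,v]_E+[v,u]_E=L(e^a,\nabla_{X_a}u,v)+L(e^a,\nabla_{X_a}v,u)$ for all $u,v$. The $E$-torsion is $T(\nabla)(u,v):=\nabla_u v-\nabla_v u-[u,v]_E^{\nabla}$, and $\nabla$ is $E$-torsion-free if $T(\nabla)=0$. The $E$-non-metricity is $Q(\nabla,g)(u,v,w)=(\nabla g)(u,v,w)=\rho(u)(g(v,w))-g(\nabla_u v,w)-g(v,\nabla_u w)$. A conjugate $E$-connection structure is a triplet $(g,\nabla,\nabla^* )$ with $g$ an $E$-metric and $\nabla,\nabla^*$ linear $E$-connections conjugate with respect to $g$: $\rho(u)(g(v,w))=g(\nabla_u v,w)+g(v,\nabla^*_u w)$ for all $u,v,w$. An $E$-statistical structure is a triplet $(g,C,B)$ with $g$ an $E$-metric, $C$ a totally symmetric $(0,3)$-type $E$-tensor (section of $E^*\otimes E^*\otimes E^*$), and $B:\mathfrak{X}(E)\times\mathfrak{X}(E)\to\mathfrak{X}(E)$ an anti-symmetric $C^\infty(M,\mathbb{R})$-bilinear map. *)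

(* Defs.v *)
From HB Require Import structures.
From mathcomp Require Import all_boot all_order all_algebra.
From mathcomp Require Import all_classical all_reals all_analysis.

Set Implicit Arguments.
Unset Strict Implicit.
Unset Printing Implicit Defensive.

Import Order.TTheory GRing.Theory Num.Theory.
Import numFieldNormedType.Exports.

Local Open Scope classical_set_scope.
Local Open Scope ring_scope.

Section SmoothOn.
Context {R : realType} {V : normedModType R}.
Implicit Types (U : set V).

(* For U open this is C^oo: every iterated directional derivative of f is
   (Frechet) differentiable at every point of U. *)
Definition smooth_on {W : normedModType R} (U : set V) (f : V -> W) : Prop :=
  forall (vs : seq V) (x : V), U x ->
    differentiable (foldl (fun h v => 'D_v h) f vs) x.

Lemma near_eq_differentiable {W : normedModType R} (f g : V -> W) (x : V) :
  (\near x, f x = g x) -> differentiable f x -> differentiable g x.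
Proof.
move=> fg df; have fgx : f x = g x by exact: (nbhs_singleton fg).
have H : g \o shift x = cst (g x) + 'd f x +o_ 0 id.
  apply/eqaddoP => e e0.
  have /eqaddoP/(_ _ e0) H := diff_locally df.
  have fg0 : \forall h \near (0 : V), f (h + x) = g (h + x).
    move: fg; rewrite (near_shift 0); apply: filterS => h /=.
    by rewrite subr0.
  near=> h; have -> : (g \o shift x - (cst (g x) + 'd f x)) h =
     (f \o shift x - (cst (f x) + 'd f x)) h.
    by rewrite !fctE /= fgx (near fg0 h).
  by near: h.
by apply/diff_locallyP; rewrite (diff_unique (diff_continuous df) H); split;
  [exact: diff_continuous|].
Unshelve. all: by end_near. Qed.

Lemma foldl_derive_eq {W : normedModType R} U (f g : V -> W) vs :
  open U -> (forall x, U x -> f x = g x) -> forall x, U x ->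
  foldl (fun h v => 'D_v h) f vs x = foldl (fun h v => 'D_v h) g vs x.
Proof.
move=> oU; elim: vs f g => [|v vs IH] f g fg x Ux /=; first exact: fg.
apply: IH => // y Uy; apply: near_eq_derive.
by apply: filterS (open_nbhs_nbhs (conj oU Uy)) => z; exact: fg.
Qed.

Lemma smooth_on_eq {W : normedModType R} U (f g : V -> W) :
  open U -> (forall x, U x -> f x = g x) -> smooth_on U f -> smooth_on U g.
Proof.
move=> oU fg sf vs x Ux; apply: near_eq_differentiable (sf vs x Ux).
apply: filterS (open_nbhs_nbhs (conj oU Ux)) => z Uz.
exact: (foldl_derive_eq vs oU fg Uz).
Qed.

Let smooth_upto {W : normedModType R} (n : nat) U (f : V -> W) :=
  forall vs x, (size vs <= n)%N -> U x ->
    differentiable (foldl (fun h v => 'D_v h) f vs) x.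

Let smooth_upto0 {W : normedModType R} n U (f : V -> W) x :
  smooth_upto n U f -> U x -> differentiable f x.
Proof. by move=> sf; exact: (sf [::]). Qed.

Let smooth_uptoW {W : normedModType R} n U (f : V -> W) :
  smooth_upto n.+1 U f -> smooth_upto n U f.
Proof. by move=> sf vs x vn; apply: sf; exact: leqW. Qed.

Let smooth_upto_derive {W : normedModType R} n U (f : V -> W) v :
  smooth_upto n.+1 U f -> smooth_upto n U ('D_v f).
Proof. by move=> sf vs x vn; exact: (sf (v :: vs)). Qed.

Let smooth_uptoS {W : normedModType R} n U (f : V -> W) (g : V -> V -> W) :
  open U -> (forall x, U x -> differentiable f x) ->
  (forall v x, U x -> g v x = 'D_v f x) ->
  (forall v, smooth_upto n U (g v)) -> smooth_upto n.+1 U f.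
Proof.
move=> oU df gf sg [|v vs] x vn Ux; first exact: df.
apply: near_eq_differentiable (sg v vs x vn Ux).
apply: filterS (open_nbhs_nbhs (conj oU Ux)) => z Uz.
by apply: (foldl_derive_eq vs oU) => // y Uy; exact: gf.
Qed.

Let smooth_uptoD {W : normedModType R} n U (f g : V -> W) :
  open U -> smooth_upto n U f -> smooth_upto n U g -> smooth_upto n U (f + g).
Proof.
move=> oU; elim: n f g => [|n IH] f g sf sg.
  move=> [|//] x _ Ux.
  by apply: differentiableD; [exact: (smooth_upto0 sf)|exact: (smooth_upto0 sg)].
apply: (@smooth_uptoS _ _ _ _ (fun v => 'D_v f + 'D_v g)) => //.
- move=> x Ux.
  by apply: differentiableD; [exact: (smooth_upto0 sf)|exact: (smooth_upto0 sg)].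
- move=> v x Ux; rewrite deriveD//; apply: diff_derivable.
    exact: (smooth_upto0 sf).
  exact: (smooth_upto0 sg).
- by move=> v; apply: IH; exact: smooth_upto_derive.
Qed.

Let smooth_uptoM n U (f g : V -> R) :
  open U -> smooth_upto n U f -> smooth_upto n U g -> smooth_upto n U (f * g).
Proof.
move=> oU; elim: n f g => [|n IH] f g sf sg.
  move=> [|//] x _ Ux.
  by apply: differentiableM; [exact: (smooth_upto0 sf)|exact: (smooth_upto0 sg)].
apply: (@smooth_uptoS _ _ _ _ (fun v => f * 'D_v g + g * 'D_v f)) => //.
- move=> x Ux.
  by apply: differentiableM; [exact: (smooth_upto0 sf)|exact: (smooth_upto0 sg)].
- move=> v x Ux; rewrite deriveM//; apply: diff_derivable.
    exact: (smooth_upto0 sf).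
  exact: (smooth_upto0 sg).
- move=> v; apply: smooth_uptoD => //; apply: IH;
    by [exact: smooth_uptoW|exact: smooth_upto_derive].
Qed.

Lemma smooth_on_cst {W : normedModType R} U (k : W) : smooth_on U (cst k).
Proof.
move=> vs; elim: vs k => [|v vs IH] k x Ux; first exact: differentiable_cst.
rewrite /= (_ : 'D_v (cst k) = cst 0); first exact: IH.
by apply/funext => y; rewrite derive_cst.
Qed.

Lemma smooth_onD {W : normedModType R} U (f g : V -> W) :
  open U -> smooth_on U f -> smooth_on U g -> smooth_on U (f + g).
Proof.
move=> oU sf sg vs x; apply: (smooth_uptoD oU (n := size vs)) => // ws y _.
  exact: sf.
exact: sg.
Qed.

Lemma smooth_onM U (f g : V -> R) :
  open U -> smooth_on U f -> smooth_on U g -> smooth_on U (f * g).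
Proof.
move=> oU sf sg vs x; apply: (smooth_uptoM oU (n := size vs)) => // ws y _.
  exact: sf.
exact: sg.
Qed.

End SmoothOn.

Record chart (R : realType) (M : topologicalType) (n : nat) := Chart {
  chart_dom : set M;
  chart_map :> M -> 'rV[R]_n;
  chart_inv : 'rV[R]_n -> M;
  chart_dom_open : open chart_dom;
  chart_img_open : open (chart_map @` chart_dom);
  chart_mapK : forall x, chart_dom x -> chart_inv (chart_map x) = x;
  chart_continuous : forall x, chart_dom x -> {for x, continuous chart_map};
  chart_inv_continuous : forall y, (chart_map @` chart_dom) y ->
    {for y, continuous chart_inv} }.

Definition chart_compat (R : realType) (M : topologicalType) (n : nat)
    (c c' : chart R M n) : Prop :=
  smooth_on (c @` (chart_dom c `&` chart_dom c')) (c' \o chart_inv c) /\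
  smooth_on (c' @` (chart_dom c `&` chart_dom c')) (c \o chart_inv c').

(* The atlas need not be maximal: the smooth structure is the one it generates.
   The Hausdorff, paracompactness and orientability conditions are separate. *)
Record smoothManifold (R : realType) (n : nat) := SmoothManifold {
  carrier :> topologicalType;
  atlas : set (chart R carrier n);
  atlas_cover : forall x, exists2 c, atlas c & chart_dom c x;
  atlas_compat : forall c c', atlas c -> atlas c' -> chart_compat c c' }.

Definition paracompact (T : topologicalType) : Prop :=
  forall C : set (set T), C `<=` open -> \bigcup_(A in C) A = setT ->
  exists D : set (set T),
    [/\ D `<=` open, \bigcup_(B in D) B = setT,
        forall B, D B -> exists2 A, C A & B `<=` A &
        forall x : T, exists2 V, nbhs x V &
          finite_set [set B | D B /\ B `&` V !=set0]].

Definition orientable (R : realType) (n : nat) (M : smoothManifold R n) : Prop :=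
  exists A : set (chart R M n),
    [/\ forall x, exists2 c, A c & chart_dom c x,
        forall c c', A c -> atlas c' -> chart_compat c c' &
        forall c c' x, A c -> A c' -> chart_dom c x -> chart_dom c' x ->
          0 < \det ('J (c' \o chart_inv c) (c x))].

Section SmoothFunctions.
Context {R : realType} {n : nat} {M : smoothManifold R n}.
Implicit Types (W : set M) (f g : M -> R).

Definition smooth_fun_on W f : Prop :=
  forall c, atlas c -> smooth_on (c @` (chart_dom c `&` W)) (f \o chart_inv c).

Lemma chart_img_openI (c : chart R M n) W :
  open W -> open (c @` (chart_dom c `&` W)).
Proof.
move=> oW; rewrite openE => _ [x [cx Wx] <-].
have cxi : (c @` chart_dom c) (c x) by exists x.
have H1 : nbhs (c x) (c @` chart_dom c).
  by apply: open_nbhs_nbhs; split => //; exact: chart_img_open.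
have H2 : nbhs (c x) (chart_inv c @^-1` W).
  apply: (chart_inv_continuous cxi); rewrite chart_mapK//.
  exact: open_nbhs_nbhs.
apply: filterS (filterI H1 H2) => _ [[y cy <-]]; rewrite /= chart_mapK// => Wy.
by exists y.
Qed.

Lemma smooth_fun_on_eq W f g : open W -> (forall x, W x -> f x = g x) ->
  smooth_fun_on W f -> smooth_fun_on W g.
Proof.
move=> oW fg sf c ac; apply: smooth_on_eq (sf c ac).
  exact: chart_img_openI.
by move=> _ [x [cx Wx] <-] /=; rewrite chart_mapK// fg.
Qed.

Lemma smooth_fun_onS W W' f : W `<=` W' ->
  smooth_fun_on W' f -> smooth_fun_on W f.
Proof.
move=> WW' sf c ac vs _ [x [cx Wx] <-]; apply: (sf c ac).
by exists x => //; split => //; exact: WW'.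
Qed.

Lemma smooth_fun_on_local W f :
  (forall x, W x -> exists2 W', W' x & smooth_fun_on W' f) ->
  smooth_fun_on W f.
Proof.
move=> sf c ac vs _ [x [cx Wx] <-]; have [W' W'x] := sf x Wx.
by apply=> //; exists x.
Qed.

Lemma smooth_fun_on_cst W (k : R) : smooth_fun_on W (fun=> k).
Proof. by move=> c _; exact: smooth_on_cst. Qed.

Lemma smooth_fun_onD W f g : open W ->
  smooth_fun_on W f -> smooth_fun_on W g -> smooth_fun_on W (fun x => f x + g x).
Proof.
move=> oW sf sg c ac; apply: (smooth_onD (chart_img_openI oW)).
  exact: sf.
exact: sg.
Qed.

Lemma smooth_fun_onM W f g : open W ->
  smooth_fun_on W f -> smooth_fun_on W g -> smooth_fun_on W (fun x => f x * g x).
Proof.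
move=> oW sf sg c ac; apply: (smooth_onM (chart_img_openI oW)).
  exact: sf.
exact: sg.
Qed.

Lemma smooth_fun_on_sum W (I : Type) (r : seq I) (f : I -> M -> R) : open W ->
  (forall i, smooth_fun_on W (f i)) ->
  smooth_fun_on W (fun x => \sum_(i <- r) f i x).
Proof.
move=> oW sf; elim: r => [|i r IH].
  by under eq_fun do rewrite big_nil; exact: smooth_fun_on_cst.
by under eq_fun do rewrite big_cons; apply: smooth_fun_onD.
Qed.

End SmoothFunctions.

Record smoothFun (R : realType) (n : nat) (M : smoothManifold R n) := SmoothFun {
  smooth_val :> M -> R;
  smooth_valP : smooth_fun_on setT smooth_val }.

Section SmoothFunRing.
Context {R : realType} {n : nat} {M : smoothManifold R n}.
Implicit Types f g h : smoothFun M.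

Lemma smoothFun_ext f g : (forall x, f x = g x) -> f = g.
Proof.
case: f g => [f sf] [g sg] /= /funext fg; rewrite fg in sf *.
by rewrite (Prop_irrelevance sf sg).
Qed.

Definition sfun_cst (k : R) : smoothFun M :=
  SmoothFun (smooth_fun_on_cst k).
Definition sfun_add f g : smoothFun M :=
  SmoothFun (smooth_fun_onD openT (smooth_valP f) (smooth_valP g)).
Definition sfun_mul f g : smoothFun M :=
  SmoothFun (smooth_fun_onM openT (smooth_valP f) (smooth_valP g)).
Definition sfun_opp f : smoothFun M := sfun_mul (sfun_cst (-1)) f.

HB.instance Definition _ := gen_eqMixin (smoothFun M).
HB.instance Definition _ := gen_choiceMixin (smoothFun M).

Fact sfun_addA : associative sfun_add.
Proof. by move=> f g h; apply: smoothFun_ext => x /=; rewrite addrA. Qed.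
Fact sfun_addC : commutative sfun_add.
Proof. by move=> f g; apply: smoothFun_ext => x /=; rewrite addrC. Qed.
Fact sfun_add0 : left_id (sfun_cst 0) sfun_add.
Proof. by move=> f; apply: smoothFun_ext => x /=; rewrite add0r. Qed.
Fact sfun_addN : left_inverse (sfun_cst 0) sfun_opp sfun_add.
Proof. by move=> f; apply: smoothFun_ext => x /=; rewrite mulN1r addNr. Qed.
HB.instance Definition _ := GRing.isZmodule.Build (smoothFun M)
  sfun_addA sfun_addC sfun_add0 sfun_addN.

Fact sfun_mulA : associative sfun_mul.
Proof. by move=> f g h; apply: smoothFun_ext => x /=; rewrite mulrA. Qed.
Fact sfun_mulC : commutative sfun_mul.
Proof. by move=> f g; apply: smoothFun_ext => x /=; rewrite mulrC. Qed.
Fact sfun_mul1 : left_id (sfun_cst 1) sfun_mul.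
Proof. by move=> f; apply: smoothFun_ext => x /=; rewrite mul1r. Qed.
Fact sfun_mulD : left_distributive sfun_mul +%R.
Proof. by move=> f g h; apply: smoothFun_ext => x /=; rewrite mulrDl. Qed.
HB.instance Definition _ := GRing.Zmodule_isComPzRing.Build (smoothFun M)
  sfun_mulA sfun_mulC sfun_mul1 sfun_mulD.

Lemma smoothFunN f x : (- f) x = - f x.
Proof. by rewrite -[RHS]mulN1r. Qed.

End SmoothFunRing.

Record trivialization (R : realType) (M : topologicalType)
    (F : M -> lmodType R) (r : nat) := Trivialization {
  triv_dom : set M;
  triv_map : forall x, {linear F x -> 'rV[R]_r};
  triv_inv : forall x, {linear 'rV[R]_r -> F x};
  triv_dom_open : open triv_dom;
  triv_mapK : forall x, triv_dom x -> cancel (triv_map x) (triv_inv x);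
  triv_invK : forall x, triv_dom x -> cancel (triv_inv x) (triv_map x) }.

(* A rank r vector bundle, given by its fibres and a cover by local
   trivializations whose transition functions are smooth maps into GL_r; this
   determines the topology and the smooth structure of the total space. *)
Record vectorBundle (R : realType) (n : nat) (M : smoothManifold R n)
    (r : nat) := VectorBundle {
  fiber :> M -> lmodType R;
  trivs : set (trivialization fiber r);
  trivs_cover : forall x, exists2 t, trivs t & triv_dom t x;
  trivs_compat : forall t t' i j, trivs t -> trivs t' ->
    smooth_fun_on (triv_dom t `&` triv_dom t')
      (fun x => triv_map t' x (triv_inv t x (delta_mx 0 i)) 0 j) }.

Record bundleSection (R : realType) (n : nat) (M : smoothManifold R n)
    (r : nat) (E : vectorBundle M r) := BundleSection {
  section_val :> forall x, E x;
  section_smooth : forall t j, trivs t ->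
    smooth_fun_on (triv_dom t) (fun x => triv_map t x (section_val x) 0 j) }.

Notation "'Γ(' E )" := (bundleSection E) (at level 0, format "'Γ(' E )").

Section SectionModule.
Context {R : realType} {n : nat} {M : smoothManifold R n}.
Context {r : nat} {E : vectorBundle M r}.
Implicit Types (u v w : Γ(E)) (f g : smoothFun M).

Lemma section_ext u v : (forall x, u x = v x) -> u = v.
Proof.
case: u v => [u su] [v sv] /= uv; have {}uv : u = v by exact: functional_extensionality_dep.
by rewrite uv in su *; rewrite (Prop_irrelevance su sv).
Qed.

Fact sec_zero_smooth t j : trivs t ->
  smooth_fun_on (triv_dom t) (fun x => triv_map t x (0 : E x) 0 j).
Proof.
by move=> _; under eq_fun do rewrite linear0 mxE; exact: smooth_fun_on_cst.
Qed.
Definition sec_zero : Γ(E) := BundleSection sec_zero_smooth.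

Fact sec_add_smooth u v t j : trivs t ->
  smooth_fun_on (triv_dom t) (fun x => triv_map t x (u x + v x) 0 j).
Proof.
move=> Et; under eq_fun do rewrite linearD mxE.
by apply: smooth_fun_onD; [exact: triv_dom_open|exact: section_smooth..].
Qed.
Definition sec_add u v : Γ(E) := BundleSection (sec_add_smooth u v).

Fact sec_scale_smooth f u t j : trivs t ->
  smooth_fun_on (triv_dom t) (fun x => triv_map t x (f x *: u x) 0 j).
Proof.
move=> Et; under eq_fun do rewrite linearZ mxE.
apply: smooth_fun_onM; [exact: triv_dom_open| |exact: section_smooth].
exact: smooth_fun_onS (smooth_valP f).
Qed.
Definition sec_scale f u : Γ(E) := BundleSection (sec_scale_smooth f u).
Definition sec_opp u : Γ(E) := sec_scale (sfun_cst (-1)) u.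

HB.instance Definition _ := gen_eqMixin Γ(E).
HB.instance Definition _ := gen_choiceMixin Γ(E).

Fact sec_addA : associative sec_add.
Proof. by move=> u v w; apply: section_ext => x /=; rewrite addrA. Qed.
Fact sec_addC : commutative sec_add.
Proof. by move=> u v; apply: section_ext => x /=; rewrite addrC. Qed.
Fact sec_add0 : left_id sec_zero sec_add.
Proof. by move=> u; apply: section_ext => x /=; rewrite add0r. Qed.
Fact sec_addN : left_inverse sec_zero sec_opp sec_add.
Proof.
move=> u; apply: section_ext => x /=.
by rewrite scaleN1r addNr.
Qed.
HB.instance Definition _ := GRing.isZmodule.Build Γ(E)
  sec_addA sec_addC sec_add0 sec_addN.

Fact sec_scaleA f g u : sec_scale f (sec_scale g u) = sec_scale (f * g) u.
Proof. by apply: section_ext => x /=; rewrite scalerA. Qed.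
Fact sec_scale1 : left_id 1 sec_scale.
Proof. by move=> u; apply: section_ext => x /=; rewrite scale1r. Qed.
Fact sec_scaleDr : right_distributive sec_scale +%R.
Proof. by move=> f u v; apply: section_ext => x /=; rewrite scalerDr. Qed.
Fact sec_scaleDl u : {morph sec_scale^~ u : f g / f + g}.
Proof. by move=> f g; apply: section_ext => x /=; rewrite scalerDl. Qed.
HB.instance Definition _ := GRing.Zmodule_isLmodule.Build (smoothFun M) Γ(E)
  sec_scaleA sec_scale1 sec_scaleDr sec_scaleDl.

End SectionModule.

Section LinearMaps.
Context {R : comPzRingType} {U V : lmodType R}.
Implicit Types f g h : {linear U -> V}.

Lemma linmap_ext f g : f =1 g -> f = g.
Proof.
case: f g => [f [[af] [sf]]] [g [[ag] [sg]]] /= /funext fg.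
move: fg af sf ag sg => /= -> af sf ag sg.
by rewrite (Prop_irrelevance af ag) (Prop_irrelevance sf sg).
Qed.

Definition linmap_zero : {linear U -> V} := \0.
Definition linmap_add f g : {linear U -> V} := f \+ g.
Definition linmap_opp f : {linear U -> V} := \- f.
Definition linmap_scale (k : R) f : {linear U -> V} := k \*: f.

Fact linmap_addA : associative linmap_add.
Proof. by move=> f g h; apply: linmap_ext => x /=; rewrite addrA. Qed.
Fact linmap_addC : commutative linmap_add.
Proof. by move=> f g; apply: linmap_ext => x /=; rewrite addrC. Qed.
Fact linmap_add0 : left_id linmap_zero linmap_add.
Proof. by move=> f; apply: linmap_ext => x /=; rewrite add0r. Qed.
Fact linmap_addN : left_inverse linmap_zero linmap_opp linmap_add.
Proof. by move=> f; apply: linmap_ext => x /=; rewrite addNr. Qed.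
HB.instance Definition _ := GRing.isZmodule.Build {linear U -> V}
  linmap_addA linmap_addC linmap_add0 linmap_addN.

Fact linmap_scaleA a b f :
  linmap_scale a (linmap_scale b f) = linmap_scale (a * b) f.
Proof. by apply: linmap_ext => x /=; rewrite scalerA. Qed.
Fact linmap_scale1 : left_id 1 linmap_scale.
Proof. by move=> f; apply: linmap_ext => x /=; rewrite scale1r. Qed.
Fact linmap_scaleDr : right_distributive linmap_scale +%R.
Proof. by move=> a f g; apply: linmap_ext => x /=; rewrite scalerDr. Qed.
Fact linmap_scaleDl f : {morph linmap_scale^~ f : a b / a + b}.
Proof. by move=> a b; apply: linmap_ext => x /=; rewrite scalerDl. Qed.
HB.instance Definition _ := GRing.Zmodule_isLmodule.Build R {linear U -> V}
  linmap_scaleA linmap_scale1 linmap_scaleDr linmap_scaleDl.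

End LinearMaps.

Section HomBundle.
Context {R : realType} {n : nat} {M : smoothManifold R n} {r s : nat}.
Variables (E : vectorBundle M r) (F : vectorBundle M s).

Definition hom_fiber (x : M) : lmodType R := {linear E x -> F x}.

Section Triv.
Variables (t : trivialization E r) (t' : trivialization F s).

Definition hom_map_fun x (phi : hom_fiber x) : 'rV[R]_(r * s) :=
  mxvec (lin1_mx (triv_map t' x \o phi \o triv_inv t x)).

Fact hom_map_linear x : linear (@hom_map_fun x).
Proof.
move=> a phi psi; rewrite /hom_map_fun -linearP; congr mxvec.
by apply/matrixP => i j; rewrite !mxE /= linearP !mxE.
Qed.

Definition hom_map x : {linear hom_fiber x -> 'rV[R]_(r * s)} :=
  HB.pack (@hom_map_fun x) (GRing.isLinear.Build _ _ _ _ _ (@hom_map_linear x)).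

Definition hom_inv_fun x (m : 'rV[R]_(r * s)) : hom_fiber x :=
  triv_inv t' x \o mulmxr (vec_mx m) \o triv_map t x.

Fact hom_inv_linear x : linear (@hom_inv_fun x).
Proof.
move=> a m m'; apply: linmap_ext => e /=.
by rewrite linearP /= mulmxDr -scalemxAr linearP.
Qed.

Definition hom_inv x : {linear 'rV[R]_(r * s) -> hom_fiber x} :=
  HB.pack (@hom_inv_fun x) (GRing.isLinear.Build _ _ _ _ _ (@hom_inv_linear x)).

Definition hom_dom := triv_dom t `&` triv_dom t'.

Fact hom_dom_open : open hom_dom.
Proof. by apply: openI; exact: triv_dom_open. Qed.

Fact hom_mapK x : hom_dom x -> cancel (hom_map x) (hom_inv x).
Proof.
move=> [tx t'x] phi; apply: linmap_ext => e /=.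
by rewrite mxvecK mul_rV_lin1 /= !triv_mapK.
Qed.

Fact hom_invK x : hom_dom x -> cancel (hom_inv x) (hom_map x).
Proof.
move=> [tx t'x] m; rewrite -[RHS]vec_mxK; congr mxvec.
by apply/matrixP => i j; rewrite mxE /= !triv_invK// -rowE mxE.
Qed.

Definition hom_triv : trivialization hom_fiber (r * s) :=
  Trivialization hom_dom_open hom_mapK hom_invK.

End Triv.

Definition hom_trivs : set (trivialization hom_fiber (r * s)) :=
  [set T | exists t t', [/\ trivs t, trivs t' & T = hom_triv t t']].

Fact hom_cover x : exists2 T, hom_trivs T & triv_dom T x.
Proof.
have [t Et tx] := trivs_cover E x; have [t' Ft' t'x] := trivs_cover F x.
by exists (hom_triv t t') => //; exists t, t'.
Qed.

Fact hom_compat T T' k l : hom_trivs T -> hom_trivs T' ->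
  smooth_fun_on (triv_dom T `&` triv_dom T')
    (fun x => triv_map T' x (triv_inv T x (delta_mx 0 k)) 0 l).
Proof.
move=> [t1 [t1' [Et1 Ft1' ->]]] [t2 [t2' [Et2 Ft2' ->]]].
case/mxvec_indexP: k => i j; case/mxvec_indexP: l => i' j' /=.
have oW : open (hom_dom t1 t1' `&` hom_dom t2 t2').
  by apply: openI; exact: hom_dom_open.
have sE := trivs_compat i' i Et2 Et1; have sF := trivs_compat j j' Ft1' Ft2'.
apply: (@smooth_fun_on_eq _ _ _ _ (fun x =>
  triv_map t1 x (triv_inv t2 x (delta_mx 0 i')) 0 i *
  triv_map t2' x (triv_inv t1' x (delta_mx 0 j)) 0 j')) => //.
  move=> x _; rewrite mxvecE !mxE /= vec_mx_delta.
  set w := triv_map t1 x _.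
  have -> : w *m delta_mx i j = w 0 i *: delta_mx 0 j :> 'rV_s.
    apply/rowP => b; rewrite !mxE (bigD1 i)//= !mxE eqxx /= big1 ?addr0//.
    by move=> a ai; rewrite !mxE (negbTE ai) mulr0.
  by rewrite !linearZ !mxE.
apply: smooth_fun_onM => //.
  by apply: smooth_fun_onS sE => x [[? ?] [? ?]].
by apply: smooth_fun_onS sF => x [[? ?] [? ?]].
Qed.

(* The fibre of Hom(E, F) at x is the space of linear maps E_x -> F_x. *)
Definition homBundle : vectorBundle M (r * s) := VectorBundle hom_cover hom_compat.

Fact hom_app_smooth (Phi : Γ(homBundle)) (u : Γ(E)) t' j : trivs t' ->
  smooth_fun_on (triv_dom t') (fun x => triv_map t' x (Phi x (u x)) 0 j).
Proof.
move=> Ft'; apply: smooth_fun_on_local => x t'x.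
have [t Et tx] := trivs_cover E x; exists (hom_dom t t') => //.
have oW := @hom_dom_open t t'.
have sPhi i := @section_smooth _ _ _ _ _ Phi (hom_triv t t') (mxvec_index i j)
  (ex_intro _ t (ex_intro _ t' (And3 Et Ft' erefl))).
apply: (@smooth_fun_on_eq _ _ _ _ (fun y => \sum_(i < r)
  triv_map t y (u y) 0 i *
  triv_map (hom_triv t t') y (Phi y) 0 (mxvec_index i j))) => //.
  move=> y [ty t'y]; rewrite -[in RHS](triv_mapK ty (u y)).
  rewrite -[RHS]/(((triv_map t' y \o Phi y \o triv_inv t y) (triv_map t y (u y))) 0 j).
  rewrite -mul_rV_lin1 mxE; apply: eq_bigr => i _.
  by rewrite /= mxvecE.
apply: smooth_fun_on_sum => // i; apply: smooth_fun_onM => //.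
by apply: smooth_fun_onS (section_smooth u i Et) => ? [].
Qed.

Definition hom_app (Phi : Γ(homBundle)) (u : Γ(E)) : Γ(F) :=
  BundleSection (hom_app_smooth Phi u).

End HomBundle.

Section LineBundle.
Context {R : realType} {n : nat} (M : smoothManifold R n).

Definition line_fiber (_ : M) : lmodType R := R^o.

Definition line_inv_fun (m : 'rV[R]_1) : R^o := m 0 0.
Fact line_inv_linear : linear line_inv_fun.
Proof. by move=> a m m'; rewrite /line_inv_fun !mxE. Qed.
Definition line_inv : {linear 'rV[R]_1 -> R^o} :=
  HB.pack line_inv_fun (GRing.isLinear.Build _ _ _ _ _ line_inv_linear).

Definition line_map_fun (a : R^o) : 'rV[R]_1 := a%:M.
Fact line_map_linear : linear line_map_fun.
Proof. by move=> a b c; apply/rowP => i; rewrite ord1 !mxE. Qed.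
Definition line_map : {linear R^o -> 'rV[R]_1} :=
  HB.pack line_map_fun (GRing.isLinear.Build _ _ _ _ _ line_map_linear).

Fact line_mapK : cancel line_map line_inv.
Proof. by move=> a; rewrite /= /line_inv_fun mxE mulr1n. Qed.
Fact line_invK : cancel line_inv line_map.
Proof. by move=> m; apply/rowP => i; rewrite ord1 mxE mulr1n. Qed.

Definition line_triv : trivialization line_fiber 1 :=
  Trivialization (openT : open [set: M]) (fun _ _ => line_mapK)
    (fun _ _ => line_invK).

Fact line_cover x : exists2 t, [set line_triv] t & triv_dom t x.
Proof. by exists line_triv. Qed.

Fact line_compat t t' i j : [set line_triv] t -> [set line_triv] t' ->
  smooth_fun_on (triv_dom t `&` triv_dom t')
    (fun x => triv_map t' x (triv_inv t x (delta_mx 0 i)) 0 j).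
Proof.
move=> -> ->.
exact: (@smooth_fun_on_cst _ _ _ _ (line_map (line_inv (delta_mx 0 i)) 0 j)).
Qed.

Definition lineBundle : vectorBundle M 1 := VectorBundle line_cover line_compat.

Fact line_section_smooth (s : Γ(lineBundle)) :
  smooth_fun_on setT (s : M -> R).
Proof.
have := @section_smooth _ _ _ _ _ s line_triv 0 erefl.
by under eq_fun do rewrite mxE mulr1n.
Qed.

Definition fun_of_line (s : Γ(lineBundle)) : smoothFun M :=
  SmoothFun (line_section_smooth s).

End LineBundle.

Section Tangent.
Context {R : realType} {n : nat} {M : smoothManifold R n}.

Record tangentVector (x : M) := TangentVector {
  tv_fun :> smoothFun M -> R;
  tv_linear : forall a f g,
    tv_fun (sfun_cst a * f + g) = a * tv_fun f + tv_fun g;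
  tv_leibniz : forall f g, tv_fun (f * g) = tv_fun f * g x + f x * tv_fun g }.

Section TangentSpace.
Context {x : M}.
Implicit Types X Y Z : tangentVector x.

Lemma tangentVector_ext X Y : (forall f, X f = Y f) -> X = Y.
Proof.
case: X Y => [X lX dX] [Y lY dY] /= /funext XY; move: XY lX dX => /= -> lX dX.
by rewrite (Prop_irrelevance lX lY) (Prop_irrelevance dX dY).
Qed.

Definition tv_zero : tangentVector x.
Proof.
by exists (fun=> 0) => *; rewrite ?mulr0 ?mul0r addr0.
Defined.

Definition tv_add X Y : tangentVector x.
Proof.
exists (fun f => X f + Y f) => [a f g|f g].
  by rewrite !tv_linear mulrDr addrACA.
by rewrite !tv_leibniz mulrDl mulrDr addrACA.
Defined.

Definition tv_scale (k : R) X : tangentVector x.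
Proof.
exists (fun f => k * X f) => [a f g|f g].
  by rewrite tv_linear mulrDr !mulrA (mulrC k).
by rewrite tv_leibniz mulrDr !mulrA (mulrC k (f x)).
Defined.

Definition tv_opp X : tangentVector x := tv_scale (-1) X.

HB.instance Definition _ := gen_eqMixin (tangentVector x).
HB.instance Definition _ := gen_choiceMixin (tangentVector x).

Fact tv_addA : associative tv_add.
Proof. by move=> X Y Z; apply: tangentVector_ext => f /=; rewrite addrA. Qed.
Fact tv_addC : commutative tv_add.
Proof. by move=> X Y; apply: tangentVector_ext => f /=; rewrite addrC. Qed.
Fact tv_add0 : left_id tv_zero tv_add.
Proof. by move=> X; apply: tangentVector_ext => f /=; rewrite add0r. Qed.
Fact tv_addN : left_inverse tv_zero tv_opp tv_add.
Proof. by move=> X; apply: tangentVector_ext => f /=; rewrite mulN1r addNr. Qed.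
HB.instance Definition _ := GRing.isZmodule.Build (tangentVector x)
  tv_addA tv_addC tv_add0 tv_addN.

Fact tv_scaleA a b X : tv_scale a (tv_scale b X) = tv_scale (a * b) X.
Proof. by apply: tangentVector_ext => f /=; rewrite mulrA. Qed.
Fact tv_scale1 : left_id 1 tv_scale.
Proof. by move=> X; apply: tangentVector_ext => f /=; rewrite mul1r. Qed.
Fact tv_scaleDr : right_distributive tv_scale +%R.
Proof. by move=> a X Y; apply: tangentVector_ext => f /=; rewrite mulrDr. Qed.
Fact tv_scaleDl X : {morph tv_scale^~ X : a b / a + b}.
Proof. by move=> a b; apply: tangentVector_ext => f /=; rewrite mulrDl. Qed.
HB.instance Definition _ := GRing.Zmodule_isLmodule.Build R (tangentVector x)
  tv_scaleA tv_scale1 tv_scaleDr tv_scaleDl.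

End TangentSpace.
End Tangent.

Section Tensors.
Context {R : realType} {n : nat} {M : smoothManifold R n} {r : nat}.

Definition dualBundle (E : vectorBundle M r) := homBundle E (lineBundle M).

(* Covariant tensors are curried: E^* (x) E^* = Hom(E, E^* ) and
   E^* (x) E^* (x) E^* = Hom(E, Hom(E, E^* )). *)
Definition tensor2Bundle (E : vectorBundle M r) := homBundle E (dualBundle E).
Definition tensor3Bundle (E : vectorBundle M r) :=
  homBundle E (tensor2Bundle E).

Context {E : vectorBundle M r}.
Implicit Types (u v w : Γ(E)) (f : smoothFun M).

Definition form_eval (om : Γ(dualBundle E)) u : smoothFun M :=
  fun_of_line (hom_app om u).
Definition tensor2_eval (g : Γ(tensor2Bundle E)) u v : smoothFun M :=
  form_eval (hom_app g u) v.
Definition tensor3_eval (C : Γ(tensor3Bundle E)) u v w : smoothFun M :=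
  tensor2_eval (hom_app C u) v w.

Lemma form_evalE om u x : form_eval om u x = om x (u x).
Proof. by []. Qed.
Lemma tensor2_evalE g u v x : tensor2_eval g u v x = g x (u x) (v x).
Proof. by []. Qed.
Lemma tensor3_evalE C u v w x : tensor3_eval C u v w x = C x (u x) (v x) (w x).
Proof. by []. Qed.

Definition Emetric (g : Γ(tensor2Bundle E)) : Prop :=
  (forall (x : M) (a b : E x), g x a b = g x b a) /\
  (forall (x : M) (a : E x), (forall b : E x, g x a b = 0) -> a = 0).

Definition totally_symmetric (C : Γ(tensor3Bundle E)) : Prop :=
  forall (x : M) (a b c : E x), C x a b c = C x b a c /\ C x a b c = C x a c b.

Definition Estatistical_structure (g : Γ(tensor2Bundle E))
    (C : Γ(tensor3Bundle E)) (B : Γ(E) -> Γ(E) -> Γ(E)) : Prop :=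
  [/\ Emetric g, totally_symmetric C,
      forall u v, B u v = - B v u,
      forall v, linear (fun u => B u v) &
      forall u, linear (fun v => B u v)].

End Tensors.

(* A vector bundle morphism E -> TM over the identity.  Smoothness is that each
   local frame field of E is sent to a smooth local vector field X, i.e. X f is
   smooth for every f in C^oo(M). *)
Record anchor (R : realType) (n : nat) (M : smoothManifold R n) (r : nat)
    (E : vectorBundle M r) := Anchor {
  anchor_map :> forall x, {linear E x -> tangentVector x};
  anchor_smooth : forall t i (f : smoothFun M), trivs t ->
    smooth_fun_on (triv_dom t)
      (fun x => anchor_map x (triv_inv t x (delta_mx 0 i)) f) }.

Section Anchored.
Context {R : realType} {n : nat} {M : smoothManifold R n} {r : nat}.
Context {E : vectorBundle M r} (rho : anchor E).
Implicit Types (u v w : Γ(E)) (f : smoothFun M) (k : R).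

Definition anchor_D_fun f (x : M) (e : E x) : R^o := rho x e f.
Fact anchor_D_linear f x : linear (@anchor_D_fun f x).
Proof. by move=> a e e'; rewrite /anchor_D_fun linearP. Qed.
Definition anchor_D_val f (x : M) : dualBundle E x :=
  HB.pack (@anchor_D_fun f x)
    (GRing.isLinear.Build _ _ _ _ _ (@anchor_D_linear f x)).
Fact anchor_D_smooth f T j : trivs T ->
  smooth_fun_on (triv_dom T) (fun x => triv_map T x (anchor_D_val f x) 0 j).
Proof.
move=> [t [t' [Et /= -> ->]]]; case/mxvec_indexP: j => i j.
have sW := @smooth_fun_onS _ _ _ _ (triv_dom t) _ (@subIsetl _ _ _)
  (anchor_smooth rho i f Et).
apply: smooth_fun_on_eq (sW setT); first exact: openI (triv_dom_open t) openT.
by move=> x _ /=; rewrite mxvecE mxE /= ord1 mxE mulr1n.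
Qed.

(* (D f)(u) = rho(u)(f) *)
Definition anchor_D f : Γ(dualBundle E) := BundleSection (@anchor_D_smooth f).

Definition anchor_act u f : smoothFun M := form_eval (anchor_D f) u.

Lemma anchor_actE u f x : anchor_act u f x = rho x (u x) f.
Proof. by []. Qed.

Definition R_bilinear (b : Γ(E) -> Γ(E) -> Γ(E)) : Prop :=
  (forall k u u' v, b (sfun_cst k *: u + u') v = sfun_cst k *: b u v + b u' v) /\
  (forall k u v v', b u (sfun_cst k *: v + v') = sfun_cst k *: b u v + b u v').

Record connection := Connection {
  conn :> Γ(E) -> Γ(E) -> Γ(E);
  conn_bilinear : R_bilinear conn;
  conn_leibniz : forall f u v,
    conn u (f *: v) = anchor_act u f *: v + f *: conn u v;
  conn_tensorial : forall f u v, conn (f *: u) v = f *: conn u v }.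

Record localAlmostLeibniz := LocalAlmostLeibniz {
  bracket : Γ(E) -> Γ(E) -> Γ(E);
  locality : Γ(dualBundle E) -> Γ(E) -> Γ(E) -> Γ(E);
  bracket_bilinear : R_bilinear bracket;
  locality_linear1 : forall u v, linear (fun om => locality om u v);
  locality_linear2 : forall om v, linear (fun u => locality om u v);
  locality_linear3 : forall om u, linear (fun v => locality om u v);
  bracket_leibniz_r : forall f u v,
    bracket u (f *: v) = anchor_act u f *: v + f *: bracket u v;
  bracket_leibniz_l : forall f u v,
    bracket (f *: u) v =
    - anchor_act v f *: u + f *: bracket u v + locality (anchor_D f) u v }.

(* (X_a) is a frame of E with dual coframe (e^a) on a neighbourhood of x.  A
   local frame is represented near x by global sections that agree with it
   there, so that connections and tensors on global sections apply to it. *)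
Definition local_frame (x : M) (X : 'I_r -> Γ(E))
    (e : 'I_r -> Γ(dualBundle E)) : Prop :=
  \forall y \near x,
    (forall a b, e a y (X b y) = (a == b)%:R) /\
    (forall w : E y, w = \sum_a (e a y w : R) *: X a y).

Section ModifiedBracket.
Variables (A : localAlmostLeibniz) (nabla : connection).

(* The section L(e^a, nabla_{X_a} u, v), whose value near any point is computed
   in any local frame; it is independent of the frame as L and nabla are
   C^oo(M)-linear in the slots contracted. *)
Definition frame_contraction u v : Γ(E) :=
  xget 0 [set s : Γ(E) | forall x X e, local_frame x X e ->
    s x = \sum_a locality A (e a) (nabla (X a) u) v x].

Definition modified_bracket u v : Γ(E) :=
  bracket A u v - frame_contraction u v.

Definition admissible : Prop := forall u v,
  bracket A u v + bracket A v u = frame_contraction u v + frame_contraction v u.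

Definition torsion u v : Γ(E) := nabla u v - nabla v u - modified_bracket u v.

Definition torsion_free : Prop := forall u v, torsion u v = 0.

End ModifiedBracket.

Definition nonmetricity (nabla : connection) (g : Γ(tensor2Bundle E)) u v w :
    smoothFun M :=
  anchor_act u (tensor2_eval g v w)
  - tensor2_eval g (nabla u v) w - tensor2_eval g v (nabla u w).

Definition conjugate_structure (g : Γ(tensor2Bundle E))
    (nabla nabla' : connection) : Prop :=
  Emetric g /\
  forall u v w, anchor_act u (tensor2_eval g v w) =
    tensor2_eval g (nabla u v) w + tensor2_eval g v (nabla' u w).

End Anchored.

(* Main.v *)
Require Import Defs.
From HB Require Import structures.
From mathcomp Require Import all_boot all_order all_algebra.
From mathcomp Require Import all_classical all_reals all_analysis.
From mathcomp Require Import ring lra.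

Set Implicit Arguments.
Unset Strict Implicit.
Unset Printing Implicit Defensive.

Import Order.TTheory GRing.Theory Num.Theory.
Import numFieldNormedType.Exports.

Local Open Scope classical_set_scope.
Local Open Scope ring_scope.

(* With D := nabla - nabla', conjugacy gives -Q(u, v, w) = g(v, D(u, w)), which
   is C^oo(M)-trilinear and symmetric in v and w; substituting the torsion-freeness
   of nabla in the condition on T(nabla') shows that D is symmetric, so that -Q
   is totally symmetric.  Moreover B(u, v) is the difference of the contractions
   L(e^a, nabla'_{X_a} u, v) - L(e^a, nabla_{X_a} u, v), hence C^oo(M)-linear in
   v, and it is antisymmetric by admissibility of nabla'.
   Two facts of differential geometry are needed, and both come from smooth
   cutoff functions on M: a C^oo(M)-linear map between spaces of sections is
   induced by a bundle morphism, and every point has a frame (X_a), (e^a) made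
   of global sections, so that the frame contraction is a well-defined section. *)

(** * Calculus of smooth functions on open subsets of normed spaces *)

Lemma smooth_on_derive {R : realType} {V W : normedModType R} (U : set V)
    (f : V -> W) v :
  smooth_on U f -> smooth_on U ('D_v f).
Proof. by move=> sf vs x Ux; exact: (sf (v :: vs)). Qed.

Lemma smooth_on_differentiable {R : realType} {V W : normedModType R}
    (U : set V) (f : V -> W) x :
  smooth_on U f -> U x -> differentiable f x.
Proof. by move=> sf; exact: (sf [::]). Qed.

Section SmoothAlgebra.
Context {R : realType} {V : normedModType R}.
Implicit Types (U : set V) (f g : V -> R).

Inductive gen_alg (G : set (V -> R)) : (V -> R) -> Prop :=
| gen_alg_base f : G f -> gen_alg G f
| gen_alg_cst k : gen_alg G (cst k)
| gen_alg_add f g : gen_alg G f -> gen_alg G g -> gen_alg G (f + g)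
| gen_alg_mul f g : gen_alg G f -> gen_alg G g -> gen_alg G (f * g).

Lemma gen_alg_sum G (I : Type) (s : seq I) (F : I -> V -> R) :
  (forall i, gen_alg G (F i)) -> gen_alg G (fun x => \sum_(i <- s) F i x).
Proof.
move=> GF; elim: s => [|i s IH].
  by under eq_fun do rewrite big_nil; exact: gen_alg_cst.
by under eq_fun do rewrite big_cons; exact: gen_alg_add.
Qed.

(* Coinduction on the order of differentiation: if the derivatives of the
   generators stay in the algebra, then so do all iterated derivatives. *)
Lemma smooth_on_gen_alg U (G : set (V -> R)) : open U ->
  (forall f, G f -> (forall x, U x -> differentiable f x) /\
    forall v, exists2 g, gen_alg G g & forall x, U x -> 'D_v f x = g x) ->
  forall f, gen_alg G f -> smooth_on U f.
Proof.
move=> oU HG.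
(* The sum and Leibniz rules carry the hypothesis on generators over to the whole algebra. *)
have HA f : gen_alg G f -> (forall x, U x -> differentiable f x) /\
    forall v, exists2 g, gen_alg G g & forall x, U x -> 'D_v f x = g x.
  elim=> {f} [f /HG//|k|f g Gf [df Df] Gg [dg Dg]|f g Gf [df Df] Gg [dg Dg]].
  - split=> [x _|v]; first exact: differentiable_cst.
    by exists (cst 0) => [|x _]; [exact: gen_alg_cst|rewrite derive_cst].
  - split=> [x Ux|v]; first by apply: differentiableD; [exact: df|exact: dg].
    have [f' Gf' Df'] := Df v; have [g' Gg' Dg'] := Dg v.
    exists (f' + g') => [|x Ux]; first exact: gen_alg_add.
    rewrite deriveD ?Df' ?Dg'//; apply: diff_derivable;
      by [exact: df|exact: dg].
  - split=> [x Ux|v]; first by apply: differentiableM; [exact: df|exact: dg].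
    have [f' Gf' Df'] := Df v; have [g' Gg' Dg'] := Dg v.
    exists (f * g' + g * f') => [|x Ux].
      by apply: gen_alg_add; exact: gen_alg_mul.
    rewrite deriveM ?Df' ?Dg'//; apply: diff_derivable;
      by [exact: df|exact: dg].
move=> f Gf vs.
have [g [Gg fg]] : exists g, gen_alg G g /\
    forall x, U x -> foldl (fun h v => 'D_v h) f vs x = g x.
  elim: vs f Gf => [|v vs IH] f Gf /=; first by exists f.
  have [_ /(_ v)[g Gg fg]] := HA _ Gf; have [h [Gh gh]] := IH _ Gg.
  exists h; split=> // x Ux; rewrite -gh//.
  exact: (foldl_derive_eq vs oU fg).
move=> x Ux; apply: (@near_eq_differentiable _ _ _ g); last exact: (HA _ Gg).1.
by apply: filterS (open_nbhs_nbhs (conj oU Ux)) => y Uy; rewrite fg.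
Qed.

(* W need not come with a basis: only the derivatives of F have to be
   expanded on finitely many vectors, with smooth coefficients. *)
Lemma smooth_on_comp {W : normedModType R} m U (U' : set W) (F : V -> W)
    (h : W -> R) (b : 'I_m -> W) (k : V -> 'I_m -> V -> R) :
  open U -> (forall x, U x -> U' (F x)) ->
  (forall x, U x -> differentiable F x) ->
  (forall v i, smooth_on U (k v i)) ->
  (forall v x, U x -> 'D_v F x = \sum_i k v i x *: b i) ->
  smooth_on U' h -> smooth_on U (h \o F).
Proof.
move=> oU UU' dF sk DF sh.
(* By the chain rule, the derivative of [h \o F] is a sum of products of some [k v i] with
   ['D_(b i) h \o F]. Letting [h] range over all smooth functions makes the generated algebra
   stable. *)
pose G := [set f : V -> R | smooth_on U f \/
  exists2 h, smooth_on U' h & f = h \o F].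
apply: (smooth_on_gen_alg oU (G := G)); last first.
  by apply: gen_alg_base; right; exists h.
move=> f [sf|[{sh}h sh ->]].
  split=> [x|v]; first exact: smooth_on_differentiable.
  by exists ('D_v f) => //; apply: gen_alg_base; left; exact: smooth_on_derive.
have dh x : U x -> differentiable h (F x).
  by move=> Ux; apply: (smooth_on_differentiable sh); exact: UU'.
split=> [x Ux|v].
  by apply: differentiable_comp; [exact: dF|exact: dh].
exists (fun x => \sum_i (k v i * ('D_(b i) h \o F)) x).
  apply: gen_alg_sum => i; apply: gen_alg_mul; apply: gen_alg_base.
    by left; exact: sk.
  by right; exists ('D_(b i) h) => //; exact: smooth_on_derive.
move=> x Ux; rewrite deriveE; last first.
  by apply: differentiable_comp; [exact: dF|exact: dh].
rewrite diff_comp; [|exact: dF|exact: dh] => /=.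
rewrite -(deriveE _ (dF x Ux)).
rewrite DF// linear_sum; apply: eq_bigr => i _.
by rewrite linearZ /= -deriveE//; exact: dh.
Qed.

(** Adjoin $1/f$ to the smooth functions: its derivative $-f^{-2} D_v f$ is a product of generators
    and a constant. *)
Lemma smooth_on_inv U f : open U -> (forall x, U x -> f x != 0) ->
  smooth_on U f -> smooth_on U (fun x => (f x)^-1).
Proof.
move=> oU f0 sf.
pose G := [set g : V -> R | smooth_on U g \/ g = (fun x => (f x)^-1)].
apply: (smooth_on_gen_alg oU (G := G)); last by apply: gen_alg_base; right.
move=> g [sg|->].
  split=> [x|v]; first exact: smooth_on_differentiable.
  by exists ('D_v g) => //; apply: gen_alg_base; left; exact: smooth_on_derive.
have df x : U x -> differentiable f x by exact: smooth_on_differentiable.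
split=> [x Ux|v]; first by apply: differentiableV; [exact: df|exact: f0].
exists (cst (-1) * ((fun x => (f x)^-1) * ((fun x => (f x)^-1) * 'D_v f))).
  apply: gen_alg_mul; first exact: gen_alg_cst.
  do 2! [apply: gen_alg_mul; first by apply: gen_alg_base; right].
  by apply: gen_alg_base; left; exact: smooth_on_derive.
move=> x Ux; rewrite deriveV ?f0//; last exact/diff_derivable/df.
by rewrite !fctE /= mulN1r expr2 invfM scaleNr mulrA.
Qed.

Lemma smooth_on_prod U (I : Type) (s : seq I) (F : I -> V -> R) : open U ->
  (forall i, smooth_on U (F i)) ->
  smooth_on U (fun x => \prod_(i <- s) F i x).
Proof.
move=> oU sF; elim: s => [|i s IH].
  by under eq_fun do rewrite big_nil; exact: smooth_on_cst.
by under eq_fun do rewrite big_cons; exact: smooth_onM.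
Qed.

End SmoothAlgebra.

(** Derivatives of matrix-valued maps are taken entrywise, so the coordinates of smooth maps form a
    family stable under derivation. *)
Lemma smooth_on_coord {R : realType} {V : normedModType R} m U
    (F : V -> 'rV[R]_m) i :
  open U -> smooth_on U F -> smooth_on U (fun x => F x 0 i).
Proof.
move=> oU sF.
pose G := [set f : V -> R | exists2 F : V -> 'rV[R]_m,
  smooth_on U F & f = (fun x => F x 0 i)].
apply: (smooth_on_gen_alg oU (G := G)); last by apply: gen_alg_base; exists F.
move=> f [{sF}F sF ->]; split=> [x Ux|v].
  apply: (@differentiable_comp _ _ _ _ F (fun A : 'rV[R]_m => A 0 i)).
    exact: (smooth_on_differentiable sF).
  exact: differentiable_coord.
exists (fun x => 'D_v F x 0 i).
  by apply: gen_alg_base; exists ('D_v F) => //; exact: smooth_on_derive.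
move=> x Ux; rewrite derive_mx ?mxE//.
by apply: diff_derivable; exact: (smooth_on_differentiable sF).
Qed.

Lemma smooth_on_comp_rV {R : realType} {V : normedModType R} m U U'
    (F : V -> 'rV[R]_m) (h : 'rV[R]_m -> R) :
  open U -> (forall x, U x -> U' (F x)) ->
  smooth_on U F -> smooth_on U' h -> smooth_on U (h \o F).
Proof.
move=> oU UU' sF; apply: (smooth_on_comp (b := fun i => delta_mx 0 i)
  (k := fun v i x => 'D_v F x 0 i)) => //.
- by move=> x; exact: smooth_on_differentiable.
- by move=> v i; apply: smooth_on_coord => //; exact: smooth_on_derive.
- by move=> v x Ux; rewrite [LHS]row_sum_delta.
Qed.

Lemma smooth_on_comp1 {R : realType} {V : normedModType R} U U'
    (F : V -> R) (h : R -> R) :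
  open U -> (forall x, U x -> U' (F x)) ->
  smooth_on U F -> smooth_on U' h -> smooth_on U (h \o F).
Proof.
move=> oU UU' sF sh.
apply: (@smooth_on_comp _ V R 1 _ _ F h (fun=> 1) (fun v _ => 'D_v F)
  oU UU' _ _ _ sh).
- by move=> x; exact: smooth_on_differentiable.
- by move=> v _; exact: smooth_on_derive.
- by move=> v x Ux; rewrite big_ord1 [RHS]mulr1.
Qed.

(** * The flat function exp(-1/x) and a bump function on the line *)

Section FlatFunction.
Context {R : realType}.
Implicit Types (p : {poly R}) (x t : R).

(** The polynomial factor makes the family stable under derivation: [p] becomes $X^2 (p - p')$. *)
Definition flat_poly p x : R := if 0 < x then p.[x^-1] * expR (- x^-1) else 0.

(** A single term of the exponential series gives $t^k e^{-t} \le k!$; sum over the coefficients of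
    [p]. With $t = 1/x$ this controls [flat_poly] near 0. *)
Lemma horner_expRN_bounded p : exists2 C : R, 0 <= C &
  forall t, 0 <= t -> `|p.[t] * expR (- t)| <= C.
Proof.
have monom k t : 0 <= t -> t ^+ k * expR (- t) <= k`!%:R :> R.
  move=> t0; rewrite expRN ler_pdivrMr ?expR_gt0//.
  case: k => [|k]; first by rewrite expr0 mul1r -expR0 ler_expR.
  have fk : 0 < (k.+1)`!%:R :> R by rewrite ltr0n fact_gt0.
  rewrite mulrC -ler_pdivrMr//.
  by apply: le_trans (expR_ge1Dxn k t0); rewrite lerDr ler01.
exists (\sum_(i < size p) `|p`_i| * i`!%:R) => [|t t0].
  by apply: sumr_ge0 => i _; rewrite mulr_ge0.
rewrite horner_coef mulr_suml; apply: le_trans (ler_norm_sum _ _ _) _.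
apply: ler_sum => i _; rewrite -mulrA normrM ler_wpM2l//.
by rewrite ger0_norm ?mulr_ge0 ?exprn_ge0 ?expR_ge0// monom.
Qed.

Lemma is_derive_flat_poly p x :
  is_derive x 1 (flat_poly p) (flat_poly ('X^2 * (p - p^`())) x).
Proof.
have [x0|x0|<-] := ltgtP 0 x.
- have dV : is_derive x 1 (fun y : R => y^-1) (- x ^- 2 *: 1).
    by apply: is_deriveV; rewrite gt_eqF.
  have dp := @is_derive1_comp R (horner p) (fun y => y^-1) x _ _
    (is_derive_poly p x^-1) dV.
  have de := @is_derive1_comp R expR (fun y => - y^-1) x _ _
    (is_derive_expR (- x^-1)) (is_deriveN dV).
  apply: (@near_eq_is_derive _ _ _ ((horner p \o (fun y => y^-1)) *
      (expR \o (fun y => - y^-1)))).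
    by near=> y; rewrite /flat_poly ifT//; near: y; exact: lt_nbhsr.
  have dM := is_deriveM dp de.
  apply: (is_derive_eq dM).
  rewrite /flat_poly x0 !hornerE /= /GRing.scale /= exprVn.
  move: (p.[_]) (p^`().[_]) (expR _) (x ^- 2) => a b c d.
  by rewrite !mulr1; ring.
- apply: (@near_eq_is_derive _ _ _ (cst 0)).
    near=> y; rewrite /flat_poly ifF//; apply/negbTE; rewrite -leNgt ltW//.
    by near: y; exact: lt_nbhsl.
  rewrite /flat_poly ltNge ltW//=; exact: is_derive_cst.
have -> : flat_poly ('X^2 * (p - p^`())) 0 = 0 by rewrite /flat_poly ltxx.
(* The factor $X^2$ absorbs the quotient: for $h > 0$, $h^{-1} p(1/h) e^{-1/h}$ is $h$ times a
   quantity bounded by [C]. *)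
have [C C0 HC] := horner_expRN_bounded ('X^2 * p).
suff H : h^-1 *: (flat_poly p (h *: 1 + 0) - flat_poly p 0) @[h --> 0^'] -->
    (0 : R).
  by split; [apply/cvg_ex; exists 0|by apply: (cvg_lim _ H)].
(* [C] may be 0, hence the division by [C + 1] below. *)
apply/cvgr0Pnorm_le => e e0; have C1 : 0 < C + 1 by rewrite ltr_wpDl.
near=> h.
have he : `|h| <= e / (C + 1) by near: h; apply: dnbhs0_le; exact: divr_gt0.
rewrite addr0 {2}/flat_poly ltxx subr0 /GRing.scale /= mulr1 /flat_poly.
case: ifPn => [h0|_]; last by rewrite mulr0 normr0 ltW.
have hV0 : 0 <= h^-1 by rewrite invr_ge0 ltW.
have := HC _ hV0; rewrite hornerM hornerXn exprVn.
set a := _ * expR _ => Hh.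
rewrite (_ : h^-1 * _ = h * a); last first.
  by rewrite /a expr2 invfM !mulrA mulfV ?gt_eqF// mul1r.
rewrite normrM; apply: (@le_trans _ _ (e / (C + 1) * (C + 1))).
  by apply: ler_pM => //; apply: le_trans Hh _; rewrite lerDl.
by rewrite divfK// gt_eqF.
Unshelve. all: by end_near. Qed.

Lemma smooth_flat_poly p : smooth_on setT (flat_poly p).
Proof.
apply: (smooth_on_gen_alg openT (G := range flat_poly)); last first.
  by apply: gen_alg_base; exists p.
move=> _ [{}p _ <-].
have df x : differentiable (flat_poly p) x.
  by apply/derivable1_diffP; have [] := is_derive_flat_poly p x.
split=> [x _//|v]; exists (cst v * flat_poly ('X^2 * (p - p^`()))).
  by apply: gen_alg_mul; [exact: gen_alg_cst|apply: gen_alg_base; eexists].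
move=> x _; rewrite deriveE// -[v in LHS]mulr1 [_ * 1]/(v *: (1 : R)) linearZ.
by rewrite /= -deriveE//; have [_ ->] := is_derive_flat_poly p x.
Qed.

(* [flat_poly 1] is exp(-1/x) on the positive half-line *)
Definition bump1 x : R :=
  flat_poly 1 (1 - x ^+ 2) /
  (flat_poly 1 (1 - x ^+ 2) + flat_poly 1 (x ^+ 2 - 4^-1)).

Lemma flat_poly1_gt0 x : 0 < x -> 0 < flat_poly 1 x.
Proof. by rewrite /flat_poly => ->; rewrite hornerE mul1r expR_gt0. Qed.

Lemma flat_poly1_ge0 x : 0 <= flat_poly 1 x.
Proof.
by rewrite /flat_poly; case: ifP => // _; rewrite hornerE mul1r expR_ge0.
Qed.

Lemma flat_poly_le0 p x : x <= 0 -> flat_poly p x = 0.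
Proof. by rewrite /flat_poly ltNge => ->. Qed.

(** The sets $x^2 < 1$ and $x^2 > 1/4$, where the two terms are positive, cover the line. *)
Let den_gt0 x :
  0 < flat_poly 1 (1 - x ^+ 2) + flat_poly 1 (x ^+ 2 - 4^-1).
Proof.
have [x1|x1] := ltP (x ^+ 2) 1.
  by rewrite ltr_wpDr ?flat_poly1_ge0// flat_poly1_gt0// subr_gt0.
rewrite ltr_wpDl ?flat_poly1_ge0// flat_poly1_gt0// subr_gt0.
by apply: lt_le_trans x1; lra.
Qed.

Lemma bump1_eq0 x : 1 <= `|x| -> bump1 x = 0.
Proof.
move=> x1; rewrite /bump1 flat_poly_le0 ?mul0r//.
by rewrite subr_le0 -real_normK ?num_real// exprn_ege1.
Qed.

Lemma bump1_eq1 x : `|x| <= 2^-1 -> bump1 x = 1.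
Proof.
move=> x1; rewrite /bump1; have d0 := den_gt0 x; move: d0.
rewrite [flat_poly 1 (x ^+ 2 - _)]flat_poly_le0 ?addr0; last first.
  rewrite subr_le0 -real_normK ?num_real//.
  rewrite (_ : 4^-1 = 2^-1 ^+ 2 :> R); last by lra.
  by rewrite ler_pXn2r ?nnegrE.
by move=> d0; rewrite divff// gt_eqF.
Qed.

Lemma smooth_bump1 : smooth_on setT bump1.
Proof.
have sid : smooth_on [set: R] (id : R -> R).
  pose G := [set (id : R -> R)].
  apply: (smooth_on_gen_alg openT (G := G)); last exact: gen_alg_base.
  move=> _ ->; split=> [x _//|v]; exists (cst v); first exact: gen_alg_cst.
  by move=> x _; rewrite derive_id.
have ssq : smooth_on [set: R] (fun x : R => x ^+ 2).
  exact: (smooth_onM openT sid sid).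
have s1 : smooth_on [set: R] (fun x => flat_poly 1 (1 - x ^+ 2)).
  apply: (@smooth_on_comp1 _ _ _ setT (fun x : R => 1 - x ^+ 2)) => //.
  - exact: openT.
  - rewrite (_ : (fun x => _) = cst 1 + cst (-1) * (fun x => x ^+ 2)).
      apply: (smooth_onD openT); first exact: smooth_on_cst.
      by apply: (smooth_onM openT) => //; exact: smooth_on_cst.
    by apply/funext => x; rewrite !fctE /= mulN1r.
  - exact: smooth_flat_poly.
have s2 : smooth_on [set: R] (fun x => flat_poly 1 (x ^+ 2 - 4^-1)).
  apply: (@smooth_on_comp1 _ _ _ setT (fun x : R => x ^+ 2 - 4^-1)) => //.
  - exact: openT.
  - by apply: (smooth_onD openT ssq); exact: smooth_on_cst.
  - exact: smooth_flat_poly.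
apply: (smooth_onM openT s1); apply: (smooth_on_inv openT).
  by move=> x _; rewrite gt_eqF// den_gt0.
exact: (smooth_onD openT s1 s2).
Qed.

End FlatFunction.

(** * Cutoff functions on coordinate space and on the manifold *)

Lemma smooth_rV_bump {R : realType} n (y0 : 'rV[R]_n) (e : R) : 0 < e ->
  exists h : 'rV[R]_n -> R,
    [/\ smooth_on setT h, \forall y \near y0, h y = 1 &
        forall (y : 'rV[R]_n) i, e < `|y 0 i - y0 0 i| -> h y = 0].
Proof.
move=> e0.
exists (fun y : 'rV_n => \prod_(i < n) bump1 ((y 0 i - y0 0 i) / e)); split.
- apply: (smooth_on_prod _ openT
    (F := fun i (y : 'rV_n) => bump1 ((y 0 i - y0 0 i) / e))) => i.
  apply: (@smooth_on_comp1 _ _ _ setT (fun y : 'rV_n => (y 0 i - y0 0 i) / e)).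
  + exact: openT.
  + by [].
  + apply: (smooth_onM openT); last exact: smooth_on_cst.
    apply: (smooth_onD openT); last exact: smooth_on_cst.
    pose G := [set (fun y : 'rV[R]_n => y 0 i)].
    apply: (smooth_on_gen_alg openT (G := G)); last exact: gen_alg_base.
    move=> _ ->; split=> [x _|v]; first exact: differentiable_coord.
    exists (cst (v 0 i)); first exact: gen_alg_cst.
    move=> x _.
    have := @derive_mx R 'rV[R]_n 1 n id x v (@derivable_id _ _ _ _).
    by move=> /matrixP/(_ 0 i); rewrite derive_id !mxE.
  + exact: smooth_bump1.
- near=> y; apply: big1 => i _; apply: bump1_eq1.
  rewrite normrM normfV (gtr0_norm e0) ler_pdivrMr//.
  rewrite distrC ltW//.
  (* Balls of row vectors are coordinate boxes, and [bump1] is 1 up to radius 1/2. *)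
  have /(_ i) : forall i, `|y0 0 i - y 0 i| < 2^-1 * e.
    near: y; apply/nbhs_ballP; exists (2^-1 * e) => /=; first exact: mulr_gt0.
    by move=> y [_ H] i; exact: H.
  by [].
- move=> y i yi; rewrite (bigD1 i)//= bump1_eq0 ?mul0r//.
  by rewrite normrM normfV (gtr0_norm e0) ler_pdivlMr// mul1r ltW.
Unshelve. all: by end_near. Qed.

(** A bump in a chart is extended by zero. It vanishes off the preimage [K] of a compact box; [K] is
    compact, hence closed because [M] is Hausdorff, so the extension is smooth across the edge of
    the chart. *)
Lemma smooth_cutoff {R : realType} {n : nat} {M : smoothManifold R n} (x : M)
    (W : set M) : hausdorff_space M -> open W -> W x ->
  exists (phi : smoothFun M) (K : set M),
    [/\ closed K, K `<=` W, forall y, ~ K y -> phi y = 0 &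
        \forall y \near x, phi y = 1].
Proof.
move=> hM oW Wx; have [c ac cx] := atlas_cover x.
have /nbhs_ballP[e /= e0 ballU] : nbhs (c x) (c @` (chart_dom c `&` W)).
  by apply: open_nbhs_nbhs; split; [exact: chart_img_openI|exists x].
(* Halving the radius puts the closed box [B] inside the open ball, hence inside the chart image. *)
have e2 : 0 < e / 2 by rewrite divr_gt0.
have [h [sh h1 h0]] := smooth_rV_bump (c x) e2.
pose B := [set y : 'rV[R]_n | forall i,
  `[c x 0 i - e / 2, c x 0 i + e / 2]%classic (y 0 i)].
have BU : B `<=` c @` (chart_dom c `&` W).
  move=> y By; apply: ballU; split=> // i j; rewrite ord1.
  have := By j; rewrite /= in_itv /= => /andP[y1 y2].
  by rewrite /ball /= ltr_distlC; apply/andP; split; lra.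
have cptB : compact B.
  apply: (@rV_compact R n
    (fun i => `[c x 0 i - e / 2, c x 0 i + e / 2]%classic)) => i.
  exact: segment_compact.
have cinv y : B y -> {for y, continuous (chart_inv c)}.
  move=> /BU[z [cz _] <-]; apply: chart_inv_continuous.
  by exists z.
pose K := chart_inv c @` B.
have clK : closed K.
  apply: (compact_closed hM).
  apply: (@continuous_compact _ _ (chart_inv c) B) => //.
  apply: continuous_in_subspaceT => y; rewrite inE; exact: cinv.
have KW : K `<=` chart_dom c `&` W.
  by move=> _ [y /BU[z [cz Wz] <-] <-]; rewrite chart_mapK.
pose f y : R := if pselect (K y) then h (c y) else 0.
have fc y : chart_dom c y -> f y = h (c y).
  move=> cy; rewrite /f; case: pselect => // nK.
  apply/esym; apply: contrapT => hy.
  apply: nK; exists (c y); last exact: chart_mapK.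
  move=> i; rewrite /= in_itv /= -ler_distlC distrC leNgt.
  by apply/negP => /h0.
have fK y : ~ K y -> f y = 0 by rewrite /f; case: pselect.
(* [M] is covered by the chart domain, where [f] is [h \o c], and by the open complement of [K],
   where [f] is 0. *)
have sf : smooth_fun_on setT f.
  apply: smooth_fun_on_local => y _; have [Ky|nKy] := pselect (K y).
    exists (chart_dom c); first exact: (KW _ Ky).1.
    apply: (@smooth_fun_on_eq _ _ _ _ (h \o c)).
    - exact: chart_dom_open.
    - by move=> z cz; rewrite fc.
    move=> c' ac'; have oU := @chart_img_openI _ _ _ c' _ (chart_dom_open c).
    have [sc _] := atlas_compat ac' ac.
    exact: (@smooth_on_comp_rV _ _ _ _ setT (c \o chart_inv c')).
  exists (~` K) => //; apply: (@smooth_fun_on_eq _ _ _ _ (fun=> 0)).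
  - exact: closed_openC.
  - by move=> z nKz; rewrite fK.
  - exact: smooth_fun_on_cst.
exists (SmoothFun sf), K; split => //=.
  by move=> y /KW[].
have : nbhs x (c @^-1` [set y | h y = 1]) by exact: (chart_continuous cx).
have cn : nbhs x (chart_dom c).
  by apply: open_nbhs_nbhs; split=> //; exact: chart_dom_open.
by apply: filterS2 cn => y cy /= hy; rewrite fc.
Qed.

(** * Cutoff frames and extension of vectors to global sections *)

Section Cutoff.
Context {R : realType} {n : nat} {M : smoothManifold R n}.
Context {s : nat} {F : vectorBundle M s}.

Lemma smoothFunM_at (f g : smoothFun M) x : (f * g) x = f x * g x.
Proof. by []. Qed.

Lemma sectionD_at (u v : Γ(F)) x : (u + v) x = u x + v x.
Proof. by []. Qed.

Lemma sectionZ_at (f : smoothFun M) (u : Γ(F)) x : (f *: u) x = f x *: u x.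
Proof. by []. Qed.

Lemma sectionN_at (u : Γ(F)) x : (- u) x = - u x.
Proof. by rewrite -scaleN1r. Qed.

Lemma section_sum_at (I : Type) (r : seq I) (u : I -> Γ(F)) x :
  (\sum_(i <- r) u i) x = \sum_(i <- r) u i x.
Proof.
by elim: r => [|i r IH]; rewrite ?big_nil// !big_cons sectionD_at IH.
Qed.

Hypothesis M_hausdorff : hausdorff_space M.

(** The frame of [t] and the coordinates of a section become global after multiplication by a cutoff
    [phi]. The formulas hold on all of [M]: off [triv_dom t], where [t] carries no information,
    [phi] is 0. *)
Lemma cutoff_frame (t : trivialization F s) x : trivs t -> triv_dom t x ->
  exists (phi : smoothFun M) (X : 'I_s -> Γ(F)),
    [/\ \forall y \near x, phi y = 1,
        forall y a, X a y = phi y *: triv_inv t y (delta_mx 0 a),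
        forall y, phi y != 0 -> triv_dom t y &
        forall u : Γ(F), exists f : 'I_s -> smoothFun M,
          forall y a, f a y = phi y * triv_map t y (u y) 0 a].
Proof.
move=> Ft tx.
have [phi [K [clK Kt phi0 phi1]]] :=
  smooth_cutoff M_hausdorff (triv_dom_open t) tx.
have cut (W : set M) (f : M -> R) : open W ->
    smooth_fun_on (W `&` triv_dom t) f ->
    smooth_fun_on W (fun y => phi y * f y).
  move=> oW sf; apply: smooth_fun_on_local => y Wy.
  have [ty|nty] := pselect (triv_dom t y).
    exists (W `&` triv_dom t) => //; apply: smooth_fun_onM => //.
      by apply: openI => //; exact: triv_dom_open.
    exact: smooth_fun_onS (smooth_valP phi).
  exists (~` K); first by move=> /Kt.
  apply: (@smooth_fun_on_eq _ _ _ _ (fun=> 0)).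
  - exact: closed_openC.
  - by move=> z nKz; rewrite phi0// mul0r.
  - exact: smooth_fun_on_cst.
have sX a t' j : trivs t' -> smooth_fun_on (triv_dom t')
    (fun y => triv_map t' y (phi y *: triv_inv t y (delta_mx 0 a)) 0 j).
  move=> Ft'; under eq_fun do rewrite linearZ mxE.
  apply: cut; first exact: triv_dom_open.
  by rewrite setIC; exact: trivs_compat.
exists phi, (fun a => BundleSection (sX a)); split=> //.
  move=> y; apply: contraNP => nty; apply/eqP/phi0.
  by move=> /Kt.
move=> u.
have sf a : smooth_fun_on setT (fun y => phi y * triv_map t y (u y) 0 a).
  by apply: cut; [exact: openT|rewrite setTI; exact: section_smooth].
by exists (fun a => SmoothFun (sf a)).
Qed.

(** One factor [phi] comes from the coordinates and one from the frame. The identity is global, so a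
    $C^\infty(M)$-linear map can be applied to it. *)
Lemma cutoff_expand (t : trivialization F s) (phi : smoothFun M)
    (X : 'I_s -> Γ(F)) (u : Γ(F)) (f : 'I_s -> smoothFun M) :
  (forall y a, X a y = phi y *: triv_inv t y (delta_mx 0 a)) ->
  (forall y, phi y != 0 -> triv_dom t y) ->
  (forall y a, f a y = phi y * triv_map t y (u y) 0 a) ->
  (phi * phi) *: u = \sum_a f a *: X a.
Proof.
move=> XE phit fE; apply: section_ext => y.
rewrite section_sum_at sectionZ_at smoothFunM_at.
have [phi0|/phit ty] := eqVneq (phi y) 0.
  rewrite phi0 mul0r scale0r big1// => a _.
  by rewrite sectionZ_at XE phi0 scale0r scaler0.
rewrite -[u y](triv_mapK ty) [in LHS](row_sum_delta (triv_map t y (u y))).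
rewrite linear_sum scaler_sumr; apply: eq_bigr => a _.
by rewrite sectionZ_at XE fE linearZ !scalerA mulrAC.
Qed.

Lemma section_ext_at x (e : F x) : exists u : Γ(F), u x = e.
Proof.
have [t Ft tx] := trivs_cover F x.
have [phi [X [phi1 XE _ _]]] := cutoff_frame Ft tx.
exists (\sum_a sfun_cst (triv_map t x e 0 a) *: X a).
rewrite section_sum_at -[RHS](triv_mapK tx).
rewrite [in RHS](row_sum_delta (triv_map t x e)).
rewrite linear_sum; apply: eq_bigr => a _.
by rewrite sectionZ_at XE (nbhs_singleton phi1) scale1r linearZ_LR.
Qed.

End Cutoff.

(** * Linear maps of sections as bundle morphisms *)

Section Tensoriality.
Context {R : realType} {n : nat} {M : smoothManifold R n}.
Hypothesis M_hausdorff : hausdorff_space M.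
Context {r s : nat} {E : vectorBundle M r} {F : vectorBundle M s}.

(** It suffices to treat [w] vanishing at [x]. Then $\phi^2 w = \sum_a f_a X_a$ with $f_a(x) = 0$,
    and applying [P] gives $P(w)(x) = 0$ since $\phi(x) = 1$. *)
Lemma linear_eq_at (P : {linear Γ(E) -> Γ(F)}) (u v : Γ(E)) x :
  u x = v x -> P u x = P v x.
Proof.
move=> uv; suff H (w : Γ(E)) : w x = 0 -> P w x = 0.
  have /H : (u - v) x = 0 by rewrite sectionD_at sectionN_at uv subrr.
  by rewrite linearB sectionD_at sectionN_at => /eqP; rewrite subr_eq0 => /eqP.
move=> w0; have [t Et tx] := trivs_cover E x.
have [phi [X [phi1 XE phit]]] := cutoff_frame M_hausdorff Et tx.
move=> /(_ w)[f fE].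
have : ((phi * phi) *: P w) x = 0.
  rewrite -linearZ (cutoff_expand XE phit fE) linear_sum section_sum_at.
  rewrite big1// => a _.
  by rewrite linearZ_LR sectionZ_at fE w0 linear0 mxE mulr0 scale0r.
by rewrite sectionZ_at smoothFunM_at (nbhs_singleton phi1) mulr1 scale1r.
Qed.

Lemma hom_app_inj (Phi Psi : Γ(homBundle E F)) :
  (forall u, hom_app Phi u = hom_app Psi u) -> Phi = Psi.
Proof.
move=> PP; apply: section_ext => x; apply: linmap_ext => e.
have [u <-] := section_ext_at M_hausdorff e.
by rewrite -[LHS]/(hom_app Phi u x) PP.
Qed.

(** On each fibre, extend a vector to a section, apply [P] and evaluate; [linear_eq_at] removes the
    dependence on the extension. *)
Lemma linear_hom_section (P : {linear Γ(E) -> Γ(F)}) :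
  exists Phi : Γ(homBundle E F), forall u, hom_app Phi u = P u.
Proof.
pose ext x (e : E x) := projT1 (cid (section_ext_at M_hausdorff e)).
have extE x (e : E x) : ext x e x = e by rewrite /ext; case: cid.
pose Pf x (e : E x) : F x := P (ext x e) x.
have PfE (u : Γ(E)) x : Pf x (u x) = P u x.
  by apply: linear_eq_at; rewrite extE.
have Pf_linear x : linear (Pf x).
  move=> a e e'; rewrite -[e in LHS]extE -[e' in LHS]extE.
  by rewrite -[_ + _ in LHS]/((sfun_cst a *: ext x e + ext x e') x) PfE linearP.
pose Pl x : homBundle E F x :=
  HB.pack (Pf x) (GRing.isLinear.Build _ _ _ _ _ (Pf_linear x)).
(* Near [x] the matrix entries of [Pl] are the coordinates of the smooth sections [P (X i)]. *)
have Pl_smooth T k : trivs T ->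
    smooth_fun_on (triv_dom T) (fun x => triv_map T x (Pl x) 0 k).
  move=> [t [t' [Et Ft' ->]]]; case/mxvec_indexP: k => i j.
  apply: smooth_fun_on_local => x [tx t'x].
  have [phi [X [phi1 XE _ _]]] := cutoff_frame M_hausdorff Et tx.
  have : nbhs x (triv_dom t').
    by apply: open_nbhs_nbhs; split=> //; exact: triv_dom_open.
  move=> /(filterI phi1); rewrite nbhsE => -[W [oW Wx] WS].
  exists W => //; apply: (@smooth_fun_on_eq _ _ _ _
    (fun y => triv_map t' y (P (X i) y) 0 j)) => //.
    move=> y /WS[/= phi1y _].
    by rewrite mxvecE !mxE /= -PfE XE phi1y scale1r.
  apply: smooth_fun_onS (section_smooth (P (X i)) j Ft').
  by move=> y /WS[].
exists (BundleSection Pl_smooth) => u.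
by apply: section_ext => x; exact: PfE.
Qed.

End Tensoriality.

(** * Tensors from multilinear maps of sections *)

Section LinearSections.
Context {R : realType} {n : nat} {M : smoothManifold R n}.
Hypothesis M_hausdorff : hausdorff_space M.

Lemma linear_hom_sectionP {r s : nat} {E : vectorBundle M r}
    {F : vectorBundle M s} (P : Γ(E) -> Γ(F)) : linear P ->
  exists Phi : Γ(homBundle E F), forall u, hom_app Phi u = P u.
Proof.
move=> P_linear; pose Pl : {linear Γ(E) -> Γ(F)} :=
  HB.pack P (GRing.isLinear.Build _ _ _ _ _ P_linear).
exact: (linear_hom_section M_hausdorff Pl).
Qed.

Lemma hom_app_linear {r s : nat} {E : vectorBundle M r} {F : vectorBundle M s}
  (u : Γ(E)) : linear (fun Phi : Γ(homBundle E F) => hom_app Phi u).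
Proof. by move=> f Phi Psi; apply: section_ext. Qed.

(** Currying: each [P a] is a section of the Hom bundle, and it depends linearly on [a] because its
    values on sections determine it. *)
Lemma bilinear_hom_section {q r s : nat} {G : vectorBundle M q}
    {E : vectorBundle M r} {F : vectorBundle M s}
    (P : Γ(G) -> Γ(E) -> Γ(F)) :
  (forall a, linear (P a)) -> (forall u, linear (P^~ u)) ->
  exists2 Q : Γ(G) -> Γ(homBundle E F), linear Q &
    forall a u, hom_app (Q a) u = P a u.
Proof.
move=> Pr Pl; pose Q a := projT1 (cid (linear_hom_sectionP (Pr a))).
have QP a u : hom_app (Q a) u = P a u by rewrite /Q; case: cid.
exists Q => // f a a'; apply: (hom_app_inj M_hausdorff) => u.
by rewrite hom_app_linear !QP Pl.
Qed.

Fact line_of_fun_smooth (f : smoothFun M) (t : trivialization _ 1) j :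
  trivs (v := lineBundle M) t ->
  smooth_fun_on (triv_dom t) (fun x => triv_map t x (f x : lineBundle M x) 0 j).
Proof.
move=> ->; rewrite ord1; under eq_fun do rewrite mxE mulr1n.
exact: smooth_valP.
Qed.

(** Converse of [fun_of_line], through which function-valued maps become maps into sections. *)
Definition line_of_fun (f : smoothFun M) : Γ(lineBundle M) :=
  BundleSection (line_of_fun_smooth f).

(** The slots are absorbed one at a time, from the last to the first, following the curried form of
    [tensor3Bundle]. *)
Lemma tensor3_of_trilinear {r : nat} {E : vectorBundle M r}
    (T : Γ(E) -> Γ(E) -> Γ(E) -> smoothFun M) :
  (forall f u u' v w, T (f *: u + u') v w = f * T u v w + T u' v w) ->
  (forall f u v v' w, T u (f *: v + v') w = f * T u v w + T u v' w) ->
  (forall f u v w w', T u v (f *: w + w') = f * T u v w + T u v w') ->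
  exists C : Γ(tensor3Bundle E), forall u v w, tensor3_eval C u v w = T u v w.
Proof.
move=> T1 T2 T3.
have Plin u v : linear (fun w => line_of_fun (T u v w)).
  by move=> f w w'; rewrite T3; apply: section_ext.
have Plin2 u w : linear (fun v => line_of_fun (T u v w)).
  by move=> f v v'; rewrite T2; apply: section_ext.
pose Q u := projT1 (cid2 (bilinear_hom_section (Plin u) (Plin2 u))).
have [Ql QP] : (forall u, linear (Q u)) /\
    forall u v w, hom_app (Q u v) w = line_of_fun (T u v w).
  by split=> u; rewrite /Q; case: cid2.
have Ql1 v : linear (Q^~ v).
  move=> f u u'; apply: (hom_app_inj M_hausdorff) => w.
  by rewrite hom_app_linear !QP T1; apply: section_ext.
have [Q3 Q3l Q3P] := bilinear_hom_section Ql Ql1.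
have [C CP] := linear_hom_sectionP Q3l.
exists C => u v w; apply: smoothFun_ext => x.
by rewrite /tensor3_eval /tensor2_eval /form_eval CP Q3P QP.
Qed.

End LinearSections.

(** * Local frames and contraction over them *)

Section FrameContraction.
Context {R : realType} {n : nat} {M : smoothManifold R n}.
Hypothesis M_hausdorff : hausdorff_space M.
Context {r : nat} {E : vectorBundle M r}.

(** The coframe is a cutoff frame of the dual bundle for the trivialization induced by [t]. Near [x]
    both cutoffs equal 1, and duality is that of the standard bases. *)
Lemma local_frame_exists (x : M) :
  exists (X : 'I_r -> Γ(E)) (e : 'I_r -> Γ(dualBundle E)), local_frame x X e.
Proof.
have [t Et tx] := trivs_cover E x.
have [phi [X [phi1 XE phit _]]] := cutoff_frame M_hausdorff Et tx.
pose t' : trivialization (lineBundle M) 1 := line_triv M.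
have Ft : trivs (v := dualBundle E) (hom_triv t t') by exists t, t'.
have [psi [Y [psi1 YE _ _]]] := cutoff_frame M_hausdorff Ft (conj tx I).
exists X, (fun a => Y (mxvec_index a 0)).
near=> y.
have phiy : phi y = 1 by near: y.
have psiy : psi y = 1 by near: y.
have ty : triv_dom t y by apply: phit; rewrite phiy oner_eq0.
have eE a (w : E y) : Y (mxvec_index a 0) y w = triv_map t y w 0 a.
  rewrite YE psiy scale1r /= /line_inv_fun vec_mx_delta mxE (bigD1 a)//= big1.
    by rewrite mxE !eqxx mulr1 addr0.
  by move=> i ia; rewrite mxE (negbTE ia) mulr0.
have XEy a : X a y = triv_inv t y (delta_mx 0 a) by rewrite XE phiy scale1r.
split=> [a b|w]; first by rewrite eE XEy triv_invK// mxE eqxx.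
rewrite -[LHS](triv_mapK ty) [in LHS](row_sum_delta (triv_map t y w)).
rewrite linear_sum; apply: eq_bigr => a _.
by rewrite eE XEy linearZ.
Unshelve. all: by end_near. Qed.

Context {s : nat} {F : vectorBundle M s}.
Variable beta : Γ(dualBundle E) -> Γ(E) -> Γ(F).
Hypothesis beta_linearl : forall y, linear (beta^~ y).
Hypothesis beta_linearr : forall om, linear (beta om).

(** With $f_{ab} = e_a(X'_b)$, at [x] one has $X'_b = \sum_a f_{ab} X_a$ and $e_a = \sum_b f_{ab}
    e'_b$. As [beta] is tensorial, both contractions equal $\sum_{a,b} f_{ab} \beta(e'_b, X_a)$
    there. *)
Lemma contraction_frame_indep x X e X' e' :
  local_frame x X e -> local_frame x X' e' ->
  (\sum_a beta (e a) (X a)) x = (\sum_a beta (e' a) (X' a)) x.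
Proof.
move=> /nbhs_singleton[_ Xx] /nbhs_singleton[_ X'x].
pose bl y : {linear Γ(dualBundle E) -> Γ(F)} :=
  HB.pack (beta^~ y) (GRing.isLinear.Build _ _ _ _ _ (@beta_linearl y)).
pose br om : {linear Γ(E) -> Γ(F)} :=
  HB.pack (beta om) (GRing.isLinear.Build _ _ _ _ _ (@beta_linearr om)).
pose f a b := form_eval (e a) (X' b).
have HX b : X' b x = (\sum_a f a b *: X a) x.
  by rewrite [LHS]Xx section_sum_at; apply: eq_bigr.
have He a : e a x = (\sum_b f a b *: e' b) x.
  apply: linmap_ext => w; rewrite [w in LHS]X'x linear_sum section_sum_at.
  rewrite [RHS](big_morph (fun l : dualBundle E x => l w) (id1 := 0)
    (op1 := +%R))//; apply: eq_bigr => b _.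
  by rewrite linearZ; exact: mulrC.
have -> : (\sum_b beta (e' b) (X' b)) x =
    (\sum_b \sum_a f a b *: beta (e' b) (X a)) x.
  rewrite !section_sum_at; apply: eq_bigr => b _.
  rewrite -[beta _ (X' b)]/(br (e' b) (X' b)).
  rewrite (linear_eq_at M_hausdorff (br (e' b)) (HX b)) linear_sum.
  by congr (section_val _ x); apply: eq_bigr => a _; rewrite linearZ_LR.
rewrite exchange_big !section_sum_at; apply: eq_bigr => a _.
rewrite -[beta (e a) _]/(bl (X a) (e a)).
rewrite (linear_eq_at M_hausdorff (bl (X a)) (He a)) linear_sum.
by congr (section_val _ x); apply: eq_bigr => b _; rewrite linearZ_LR.
Qed.

Lemma contraction_section : exists s : Γ(F), forall x X e,
  local_frame x X e -> s x = \sum_a beta (e a) (X a) x.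
Proof.
pose X x := projT1 (cid (local_frame_exists x)).
pose e x := projT1 (cid (projT2 (cid (local_frame_exists x)))).
have Xe x : local_frame x (X x) (e x).
  exact: projT2 (cid (projT2 (cid (local_frame_exists x)))).
pose S x := (\sum_a beta (e x a) (X x a)) x.
have SE x X0 e0 : local_frame x X0 e0 -> S x = (\sum_a beta (e0 a) (X0 a)) x.
  exact: contraction_frame_indep.
have S_smooth t j : trivs t ->
    smooth_fun_on (triv_dom t) (fun x => triv_map t x (S x) 0 j).
  move=> Ft; apply: smooth_fun_on_local => x tx.
  (* A frame near [x] is also one near each nearby point, so [S] agrees around [x] with a single
     global section. *)
  have : \forall y \near x, local_frame y (X x) (e x).
    have := Xe x; rewrite /local_frame => /nbhs_interior; apply: filterS => y.
    by rewrite /interior.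
  have : nbhs x (triv_dom t).
    by apply: open_nbhs_nbhs; split=> //; exact: triv_dom_open.
  move=> /filterI/[apply]; rewrite nbhsE => -[W [oW Wx] WS].
  exists W => //; apply: (@smooth_fun_on_eq _ _ _ _
    (fun y => triv_map t y ((\sum_a beta (e x a) (X x a)) y) 0 j)) => //.
    by move=> y /WS[_ /SE->].
  apply: smooth_fun_onS (section_smooth _ j Ft).
  by move=> y /WS[].
exists (BundleSection S_smooth) => x X0 e0 /SE H.
by rewrite -section_sum_at -H.
Qed.

End FrameContraction.

(** * Tensoriality of connections and of the modified bracket *)

Section Connections.
Context {R : realType} {n : nat} {M : smoothManifold R n}.
Context {r : nat} {E : vectorBundle M r} {rho : anchor E}.
Implicit Types (u v w : Γ(E)) (f : smoothFun M).

Lemma conn_linearl (nabla : connection rho) v : linear (nabla^~ v).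
Proof.
move=> f u u'; have [/(_ 1 (f *: u) u' v) + _] := conn_bilinear nabla.
by rewrite !scale1r conn_tensorial.
Qed.

Lemma connDr (nabla : connection rho) u v v' :
  nabla u (v + v') = nabla u v + nabla u v'.
Proof.
by have [_ /(_ 1 u v v')] := conn_bilinear nabla; rewrite !scale1r.
Qed.

(** The derivative terms $\rho(u)(f) v$ of the two Leibniz rules cancel. *)
Lemma conn_diff_linearr (nabla nabla' : connection rho) u :
  linear (fun v => nabla u v - nabla' u v).
Proof.
move=> f v v'; rewrite !connDr !conn_leibniz scalerBr; set a := _ *: v.
rewrite -(addrA a) -(addrA a _ (nabla' u v')) opprD addrACA subrr add0r.
by rewrite opprD addrACA.
Qed.

(** By [contraction_section] the set from which [xget] chooses is inhabited, so the default 0 is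
    never returned. *)
Lemma frame_contractionE (A : localAlmostLeibniz rho) (nabla : connection rho)
    u v x X e : hausdorff_space M -> local_frame x X e ->
  frame_contraction A nabla u v x = \sum_a locality A (e a) (nabla (X a) u) v x.
Proof.
move=> hM xXe.
have bl y : linear (fun om => locality A om (nabla y u) v).
  exact: locality_linear1.
have br om : linear (fun y => locality A om (nabla y u) v).
  move=> f y y'; rewrite (conn_linearl nabla u f y y').
  exact: locality_linear2.
have ex := contraction_section hM bl br.
exact: (xgetPex 0 ex).
Qed.

End Connections.

Theorem mainTheorem2 (R : realType) (n : nat) (M : smoothManifold R n)
    (M_hausdorff : hausdorff_space M) (M_paracompact : paracompact M)
    (M_orientable : orientable M)
    (r : nat) (E : vectorBundle M r) (rho : anchor E)
    (A : localAlmostLeibniz rho) (g : Γ(tensor2Bundle E))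
    (nabla nabla' : connection rho)
    (conj_nabla : conjugate_structure g nabla nabla')
    (adm_nabla : admissible A nabla) (adm_nabla' : admissible A nabla')
    (tf_nabla : torsion_free A nabla)
    (torsion_nabla' : forall u v : Γ(E), torsion A nabla' u v =
      modified_bracket A nabla u v - modified_bracket A nabla' u v) :
  exists C : Γ(tensor3Bundle E),
    (forall u v w : Γ(E),
      tensor3_eval C u v w = - nonmetricity nabla g u v w) /\
    Estatistical_structure g C (torsion A nabla').
Proof.
case: conj_nabla => -[g_sym g_nondeg] g_conj.
pose D u w := nabla u w - nabla' u w.
(* Both [nabla u v - nabla v u] and [nabla' u v - nabla' v u] equal the modified bracket of
   [nabla]. *)
have D_sym u v : D u v = D v u.
  have /eqP := tf_nabla u v; rewrite subr_eq0 => /eqP tf.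
  have := torsion_nabla' u v; rewrite /torsion -tf => /addIr tf'.
  by apply/eqP; rewrite subr_eq -addrA (addrC (- _)) tf' addrC subrK.
have Dl v : linear (D^~ v).
  move=> f u u'; rewrite /D.
  rewrite (conn_linearl nabla v f u u') (conn_linearl nabla' v f u u').
  by rewrite scalerBr opprD addrACA.
have Dr u : linear (D u) by exact: conn_diff_linearr.
pose T u v w := tensor2_eval g v (D u w).
have T_nonmet u v w : T u v w = - nonmetricity nabla g u v w.
  rewrite /T /nonmetricity g_conj (addrC (tensor2_eval g _ w)) addrK opprB.
  apply: smoothFun_ext => x.
  rewrite [RHS]/(_ + (- _ : smoothFun M) x) smoothFunN !tensor2_evalE.
  by rewrite sectionD_at sectionN_at linearB.
have g_symE v w : tensor2_eval g v w = tensor2_eval g w v.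
  by apply: smoothFun_ext => x; rewrite !tensor2_evalE g_sym.
have T23 u v w : T u v w = T u w v.
  rewrite !T_nonmet /nonmetricity (g_symE v w) (g_symE v (nabla u w)).
  by rewrite (g_symE (nabla u v)) addrAC.
(* After exchanging [v] and [w], the arguments [u] and [v] both sit in the symmetric [D]. *)
have T12 u v w : T u v w = T v u w.
  by rewrite T23 /T D_sym -/(T v w u) T23.
(* Linearity in the last slot is that of [D u]; the symmetries transport it to the other two. *)
have T3 f u v w w' : T u v (f *: w + w') = f * T u v w + T u v w'.
  by rewrite /T Dr; apply: smoothFun_ext => x; rewrite tensor2_evalE linearP.
have T2 f u v v' w : T u (f *: v + v') w = f * T u v w + T u v' w.
  by rewrite T23 T3 !(T23 u w).
have T1 f u u' v w : T (f *: u + u') v w = f * T u v w + T u' v w.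
  by rewrite T12 T2 !(T12 v).
have [C CT] := tensor3_of_trilinear M_hausdorff T1 T2 T3.
have Bv u v x : torsion A nabla' u v x =
    frame_contraction A nabla' u v x - frame_contraction A nabla u v x.
  rewrite torsion_nabla' /modified_bracket opprB addrC addrA subrK.
  by rewrite sectionD_at sectionN_at.
have Br u : linear (torsion A nabla' u).
  move=> f v v'; apply: section_ext => x.
  (* Both contractions are computed in one frame, where linearity in [v] is that of [locality] in
     its third slot. *)
  have [X [e xXe]] := local_frame_exists M_hausdorff (E := E) x.
  rewrite [LHS]Bv [RHS]sectionD_at sectionZ_at !Bv.
  rewrite !(frame_contractionE _ _ _ _ M_hausdorff xXe).
  rewrite -!sumrB scaler_sumr -big_split; apply: eq_bigr => a _ /=.
  rewrite (locality_linear3 A (e a) (nabla (X a) u) f v v').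
  rewrite (locality_linear3 A (e a) (nabla' (X a) u) f v v').
  by rewrite !(sectionD_at, sectionZ_at) scalerBr opprD addrACA.
have B_anti u v : torsion A nabla' u v = - torsion A nabla' v u.
  (* Admissibility of [nabla'] says exactly that its modified bracket is antisymmetric. *)
  have mb_anti :
      modified_bracket A nabla' v u = - modified_bracket A nabla' u v.
    apply/eqP; rewrite -addr_eq0 /modified_bracket addrACA -opprD.
    by rewrite adm_nabla' subrr.
  rewrite /torsion mb_anti; move: (modified_bracket _ _ _ _) => m.
  by rewrite opprK opprD opprB.
exists C; split=> [u v w|]; first by rewrite CT.
split=> //.
  (* Total symmetry is a fibrewise statement, so the three vectors are first extended to
     sections. *)
  move=> x a b c.
  have [u <-] := section_ext_at M_hausdorff a.
  have [v <-] := section_ext_at M_hausdorff b.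
  have [w <-] := section_ext_at M_hausdorff c.
  rewrite -!tensor3_evalE !CT; split; first by rewrite T12.
  by rewrite T23.
(* Linearity in the first slot follows from that in the second by antisymmetry. *)
move=> v f u u'; rewrite B_anti Br opprD -scalerN.
by rewrite -!(B_anti _ v).
Qed.
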